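(* Let $n\ge2$ and, for $0<r<R<\infty$, let $\mathcal{A}_r^R=\{x\in\mathbb{R}^n;\ r<|x|<R\}$. For all $0<r<R<\infty$ we have $$C_B(\mathcal{A}_r^R)>n.$$ Moreover, $\displaystyle\lim_{R\downarrow r}C_B(\mathcal{A}_r^R)=\infty$, with the following lower bound: $$\liminf_{R\downarrow r}\left(\frac Rr-1\right)^2C_B(\mathcal{A}_r^R)\ge\frac3{n-1}.$$
   Context: $L^2_0(\Omega,\mathbb{R})$ is the space of zero-mean functions in $L^2(\Omega,\mathbb{R})$. For a bounded Lipschitz domain $\Omega\subset\mathbb{R}^n$, the Bogovskii constant is $$C_B(\Omega)=\sup_{f\in L^2_0(\Omega,\mathbb{R}),\ \|f\|_{L^2(\Omega)}=1}\ \inf\Big\{\|\nabla v\|_{L^2(\Omega)}^2;\ v\in H^1_0(\Omega,\mathbb{R}^n),\ \nabla\cdot v=f\text{ in }\Omega\Big\}.$$ *)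

(* Defs.v *)
From HB Require Import structures.
From mathcomp Require Import all_boot all_order all_algebra.
From mathcomp Require Import all_classical all_reals all_analysis.

Set Implicit Arguments.
Unset Strict Implicit.
Unset Printing Implicit Defensive.

Import Order.TTheory GRing.Theory Num.Theory.
Import numFieldNormedType.Exports.

Local Open Scope classical_set_scope.
Local Open Scope ring_scope.

Definition rV_display : measure_display. Proof. exact: default_measure_display. Qed.

(* The sigma-algebra generated by the coordinates, which is the Borel one. *)
Section measurable_rV.
Context {R : realType} (n : nat).

Let coors (i : 'I_n) (x : 'rV[R]_n) : measurableTypeR R := x ord0 i.

Let rV_set0 : g_sigma_preimage coors set0.
Proof. exact: sigma_algebra0. Qed.

Let rV_setC A : g_sigma_preimage coors A -> g_sigma_preimage coors (~` A).
Proof. exact: sigma_algebraC. Qed.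

Let rV_bigcup (F : (set 'rV[R]_n)^nat) :
  (forall i, g_sigma_preimage coors (F i)) ->
  g_sigma_preimage coors (\bigcup_i F i).
Proof. exact: sigma_algebra_bigcup. Qed.

HB.instance Definition _ := @isMeasurable.Build rV_display
  'rV[R]_n (g_sigma_preimage coors) rV_set0 rV_setC rV_bigcup.

Lemma measurable_coor (i : 'I_n) :
  measurable_fun setT (fun x : 'rV[R]_n => x ord0 i : measurableTypeR R).
Proof.
move=> _ Y mY; rewrite setTI; apply: sub_sigma_algebra => /=.
rewrite -bigcup_seq/=; exists i => /=; first by rewrite mem_index_enum.
by exists Y => //; rewrite setTI.
Qed.

Lemma measurable_fun_rVP d (T : measurableType d) (f : T -> 'rV[R]_n) :
  (forall i, measurable_fun setT (fun x => f x ord0 i : measurableTypeR R)) ->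
  measurable_fun setT f.
Proof.
move=> mf _ A mA; rewrite setTI.
have : preimage_set_system setT f (g_sigma_preimage coors) (f @^-1` A).
  by exists A => //; rewrite setTI.
rewrite -g_sigma_preimage_comp; apply: smallest_sub.
  exact: sigma_algebra_measurable.
move=> B; rewrite -bigcup_seq => -[i _ [C mC <-]].
exact: mf.
Qed.

End measurable_rV.

Section cons_rV.
Context {R : realType} (n : nat).

Definition cons_rV (p : measurableTypeR R * 'rV[R]_n) : 'rV[R]_n.+1 :=
  row_mx (const_mx p.1 : 'rV[R]_1) p.2.

Definition uncons_rV (x : 'rV[R]_n.+1) : measurableTypeR R * 'rV[R]_n :=
  (x ord0 ord0, rsubmx (x : 'rV[R]_(1 + n))).

Lemma cons_rVK : cancel cons_rV uncons_rV.
Proof.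
case=> a y; rewrite /uncons_rV /cons_rV /=; congr pair; last exact: row_mxKr.
have -> : ord0 = lshift n (ord0 : 'I_1) :> 'I_(1 + n) by apply/val_inj.
by rewrite (row_mxEl (const_mx a : 'rV[R]_1)) mxE.
Qed.

Lemma cons_rV0 p : cons_rV p ord0 ord0 = p.1.
Proof. exact: (congr1 fst (cons_rVK p)). Qed.

Lemma cons_rV_lift p i : cons_rV p ord0 (lift ord0 i) = p.2 ord0 i.
Proof.
rewrite /cons_rV; have -> : lift ord0 i = rshift 1 i :> 'I_(1 + n).
  by apply/val_inj.
by rewrite (row_mxEr (const_mx p.1 : 'rV[R]_1)).
Qed.

Lemma measurable_cons_rV : measurable_fun setT cons_rV.
Proof.
apply: measurable_fun_rVP => i; case: (unliftP ord0 i) => [j|] ->.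
  under eq_fun do rewrite cons_rV_lift.
  apply: (@measurableT_comp _ _ _ _ _ _
    (fun y : 'rV[R]_n => y ord0 j : measurableTypeR R)) => //.
  exact: measurable_coor.
under eq_fun do rewrite cons_rV0.
exact: measurable_fst.
Qed.

Lemma measurable_uncons_rV : measurable_fun setT uncons_rV.
Proof.
apply/measurable_fun_pair => //=.
  exact: (@measurable_coor R n.+1).
apply: measurable_fun_rVP => i.
under eq_fun do rewrite mxE.
exact: (@measurable_coor R n.+1).
Qed.

End cons_rV.

Section lebesgue_cons.
Context {R : realType} (n : nat).
Variable mu : {sigma_finite_measure set 'rV[R]_n -> \bar R}.

Definition lebesgue_cons : set 'rV[R]_n.+1 -> \bar R :=
  pushforward (lebesgue_measure \x mu)%E (@cons_rV R n).

Let lebesgue_cons0 : lebesgue_cons set0 = 0%E.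
Proof. by rewrite /lebesgue_cons /pushforward preimage_set0 measure0. Qed.

Let lebesgue_cons_ge0 A : (0 <= lebesgue_cons A)%E.
Proof. by apply: integral_ge0 => x _; exact: measure_ge0. Qed.

Let lebesgue_cons_sigma_additive : semi_sigma_additive lebesgue_cons.
Proof.
move=> F mF tF mUF; rewrite /lebesgue_cons /pushforward preimage_bigcup.
apply: measure_semi_sigma_additive.
- by move=> k; rewrite -[X in measurable X]setTI; exact: measurable_cons_rV.
- apply/trivIsetP => /= i j _ _ ij; rewrite -preimage_setI.
  by move/trivIsetP : tF => /(_ _ _ _ _ ij) ->//; rewrite preimage_set0.
- rewrite -preimage_bigcup -[X in measurable X]setTI.
  exact: measurable_cons_rV.
Qed.

HB.instance Definition _ := isMeasure.Build _ _ _ lebesgue_cons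
  lebesgue_cons0 lebesgue_cons_ge0 lebesgue_cons_sigma_additive.

Let lebesgue_cons_sigma_finite : sigma_finite setT lebesgue_cons.
Proof.
have /sigma_finiteP[F [TF ndF Foo]] := sigma_finiteT (@lebesgue_measure R).
have /sigma_finiteP[G [TG ndG Goo]] := sigma_finiteT mu.
have mFG k : measurable (F k `*` G k).
  by apply: measurableX; [exact: (Foo k).1|exact: (Goo k).1].
exists (fun k => @uncons_rV R n @^-1` (F k `*` G k)).
  rewrite -preimage_bigcup -(preimage_setT (@uncons_rV R n)); congr preimage.
  rewrite -setXTT TF TG predeqE => -[x y]; split.
    move=> [/= [k _ Fx] [l _ Gy]]; exists (maxn k l) => //; split.
    - by move: x Fx; exact/subsetPset/ndF/leq_maxl.
    - by move: y Gy; exact/subsetPset/ndG/leq_maxr.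
  by move=> [k _ []/= ? ?]; split; exists k.
move=> k; split.
  by rewrite -[X in measurable X]setTI; exact: measurable_uncons_rV.
have [mF Foo'] := Foo k; have [mG Goo'] := Goo k.
rewrite /lebesgue_cons /pushforward -comp_preimage.
rewrite (_ : _ \o _ = id); last by apply/funext => p /=; rewrite cons_rVK.
by rewrite preimage_id product_measure1E// lte_mul_pinfty// ge0_fin_numE.
Qed.

HB.instance Definition _ := Measure_isSigmaFinite.Build _ _ _ lebesgue_cons
  lebesgue_cons_sigma_finite.

End lebesgue_cons.

(* On R^0 the measure is the unit mass at the unique point; see [lebesgue_rV_box]. *)
Fixpoint lebesgue_rV {R : realType} (n : nat) :
    {sigma_finite_measure set 'rV[R]_n -> \bar R} :=
  match n with
  | 0 => @dirac _ 'rV[R]_0 0 R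
  | n'.+1 => lebesgue_cons (lebesgue_rV n')
  end.

Lemma lebesgue_rV_box {R : realType} (n : nat)
    (A : 'I_n -> set (measurableTypeR R)) :
  (forall i, measurable (A i)) ->
  lebesgue_rV n [set x | forall i, A i (x ord0 i)] =
  (\prod_(i < n) lebesgue_measure (A i))%E.
Proof.
elim: n A => [|n IH] A mA.
  rewrite big_ord0 /= diracE mem_set //.
  by case.
rewrite big_ord_recl -IH; last by move=> i; exact: mA.
rewrite /= /lebesgue_cons /pushforward.
have -> : @cons_rV R n @^-1` [set x | forall i, A i (x ord0 i)] =
    A ord0 `*` [set x : 'rV[R]_n | forall i, A (lift ord0 i) (x ord0 i)].
  apply/seteqP; split => [[a y] /= h|[a y] /= [h0 h] i].
    split; first by have := h ord0; rewrite cons_rV0.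
    by move=> i; have := h (lift ord0 i); rewrite cons_rV_lift.
  by case: (unliftP ord0 i) => [j|] ->; rewrite ?cons_rV_lift ?cons_rV0.
rewrite product_measure1E //.
rewrite (_ : mkset _ = \bigcap_(i in [set: 'I_n])
  ((fun x : 'rV[R]_n => x ord0 i) @^-1` A (lift ord0 i))).
  apply: fin_bigcap_measurable => // i _.
  rewrite -[X in measurable X]setTI.
  exact: measurable_coor.
by apply/seteqP; split=> [x h i _|x h i]; exact: h.
Qed.

Section function_spaces.
Context {R : realType} {n : nat}.
Implicit Types (Omega : set 'rV[R]_n) (u f phi : 'rV[R]_n -> R).

Definition in_L2 Omega u : Prop := u \_ Omega \in Lfun (lebesgue_rV n) 2%:E.

Definition L2norm Omega u : \bar R :=
  'N[lebesgue_rV n]_2%:E [EFin \o u \_ Omega]%E.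

Definition in_L20 Omega f : Prop :=
  in_L2 Omega f /\ (\int[lebesgue_rV n]_(x in Omega) (f x)%:E = 0)%E.

Definition partial (j : 'I_n) phi : 'rV[R]_n -> R :=
  fun x => 'D_(delta_mx ord0 j) phi x.

Definition iter_partial (s : seq 'I_n) phi : 'rV[R]_n -> R :=
  foldr partial phi s.

(* [derive] is a total operator, hence the separate derivability clause. *)
Definition smooth phi : Prop := forall s : seq 'I_n,
  continuous (iter_partial s phi) /\
  forall j x, derivable (iter_partial s phi) x (delta_mx ord0 j).

Definition supp phi : set 'rV[R]_n := closure [set x | phi x != 0].

Definition test_function Omega phi : Prop :=
  [/\ smooth phi, compact (supp phi) & supp phi `<=` Omega].

Definition weak_gradient Omega u (g : 'rV[R]_n -> 'rV[R]_n) : Prop :=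
  forall phi, test_function Omega phi -> forall j,
  (\int[lebesgue_rV n]_(x in Omega) (u x * partial j phi x)%:E =
   - \int[lebesgue_rV n]_(x in Omega) (g x ord0 j * phi x)%:E)%E.

(* [in_H1 Omega u g] and [in_H10 Omega u g]: u belongs to H^1(Omega),
   respectively H^1_0(Omega), and g represents its weak gradient, which u
   determines almost everywhere. H^1_0 is the closure of the test functions
   in H^1. *)
Definition in_H1 Omega u (g : 'rV[R]_n -> 'rV[R]_n) : Prop :=
  [/\ in_L2 Omega u, forall j, in_L2 Omega (fun x => g x ord0 j) &
      weak_gradient Omega u g].

Definition in_H10 Omega u (g : 'rV[R]_n -> 'rV[R]_n) : Prop :=
  in_H1 Omega u g /\
  exists phi_ : nat -> 'rV[R]_n -> R,
  [/\ forall k, test_function Omega (phi_ k),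
      L2norm Omega (fun x => phi_ k x - u x) @[k --> \oo] --> 0%E &
      forall j, L2norm Omega (fun x => partial j (phi_ k) x - g x ord0 j)
        @[k --> \oo] --> 0%E].

(* Row i of [G x] is the gradient of the i-th component of v at x. *)
Definition in_H10_vec Omega (v : 'rV[R]_n -> 'rV[R]_n) (G : 'rV[R]_n -> 'M[R]_n) :
    Prop :=
  forall i, in_H10 Omega (fun x => v x ord0 i) (fun x => row i (G x)).

Definition dirichlet Omega (G : 'rV[R]_n -> 'M[R]_n) : \bar R :=
  (\sum_(i < n) \sum_(j < n) L2norm Omega (fun x => G x i j) ^+ 2)%E.

(* The trace of the gradient matrix is the divergence. *)
Definition div_eq Omega (G : 'rV[R]_n -> 'M[R]_n) f : Prop :=
  {ae lebesgue_rV n, forall x, Omega x -> \tr (G x) = f x}.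

(* An infimum over the empty set is +oo. *)
Definition bogovskii_constant Omega : \bar R :=
  ereal_sup [set ereal_inf [set dirichlet Omega G |
                 G in [set G | exists v, in_H10_vec Omega v G /\
                                         div_eq Omega G f]] |
     f in [set f | in_L20 Omega f /\ L2norm Omega f = 1%E]].

(* The norm of the library on ['rV[R]_n] is the sup norm. *)
Definition enorm (x : 'rV[R]_n) : R := Num.sqrt (\sum_(i < n) x ord0 i ^+ 2).

Definition annulus (r s : R) : set 'rV[R]_n := [set x | r < enorm x < s].

End function_spaces.

Arguments annulus {R} n r s.

(* Main.v *)
Require Import Defs.
From mathcomp Require Import all_boot all_order all_algebra.
From mathcomp Require Import all_classical all_reals all_analysis.
From mathcomp Require Import measurable_realfun ring lra.

Set Implicit Arguments.
Unset Strict Implicit.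
Unset Printing Implicit Defensive.

Import Order.TTheory GRing.Theory Num.Theory.
Import numFieldNormedType.Exports.

Local Open Scope classical_set_scope.
Local Open Scope ring_scope.

(** Write A for the annulus r < |x| < s and C for its Bogovskii constant.

    Lower bounds for C come from duality.  Suppose that a function f of mean
    zero on a domain Omega and a matrix field M satisfy grad f = div M (row by
    row) in the sense of distributions.  Then every v in H^1_0 with div v = f
    satisfies

      int f^2 = int f div v = - <grad f, v> = int M : grad v,

    so that int |grad v|^2 >= (int f^2)^2 / int |M|^2 and therefore
    C >= int f^2 / int |M|^2.  Since both sides of the identity only involve
    first derivatives, it is enough to know it for test functions
    ([weak_dual_field_H10], [bogovskii_constant_ge]).

    On the annulus take f = x_j, so that grad f is the constant vector e_j, and
    let the j-th row of M be a radial field of divergence 1, the other rows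
    being zero.  The radial fields of divergence 1 are

      x (1/n - c |x|^-n),        c a constant,

    whose energy does not depend on j.  As the integrals of x_j^2 add up to the
    integral of |x|^2, some j has int x_j^2 >= (1/n) int |x|^2, hence
    ([bogovskii_annulus_ge])

      C >= (1/n) int |x|^2 / int |x|^2 (1/n - c |x|^-n)^2.

    For c = 0 this quotient is exactly n; it is the bound one gets on a ball.
    On an annulus the singularity at the origin is invisible, and c = r^n / n
    makes the factor n (1/n - c |x|^-n) = 1 - (r/|x|)^n range in an interval
    [0, theta] with theta < 1; hence C >= n / theta^2 > n
    ([bogovskii_annulus_gt]).

    For a thin annulus choose c such that the field vanishes on the sphere of
    radius m = (r + s)/2.  Up to a factor tending to 1 its norm is then
    | |x| - m |, which is at most (s - r)/2, and at most (s - r)/4 on the middle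
    half of the shell.  That middle half carries asymptotically half of the
    volume, so the energy is at most about
    (1/2 * 1/4 + 1/2 * 1/16) (s - r)^2 = (5/32) (s - r)^2 times the volume, and
    (s/r - 1)^2 C is asymptotically at least 32 / (5 n) > 3 / (n - 1)
    ([bogovskii_annulus_thin]).  This crude count of the volume replaces the
    exact value 1/12 that polar coordinates would give in place of 5/32.

    The measure theoretic input is the behaviour of the Lebesgue measure under
    x |-> a x + b: translations give the vanishing of the integral of a
    derivative, the reflection x |-> - x gives the mean value of x_j, and
    dilations give the volumes of shells. *)

(** * Affine changes of variables for the Lebesgue measure *)

Section affine.
Context {R : realType}.
Local Notation leb := (@lebesgue_measure R).

(** Both sides are measures in [X], and they agree on the intervals ]u, v]; a
    negative [a] reverses such an interval, which only moves its endpoints. *)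
Lemma lebesgue_measure_affine (a b : R) (X : set (measurableTypeR R)) :
  a != 0 -> measurable X ->
  (`|a|%:E * leb ((fun x => (a * x + b)%R) @^-1` X))%E = leb X.
Proof.
move=> a0 mX.
have mf : measurable_fun setT
    (fun x : measurableTypeR R => a * x + b : measurableTypeR R).
  exact: measurable_funD.
pose m : {measure set (measurableTypeR R) -> \bar R} :=
  mscale (NngNum (normr_ge0 a)) (measure_function_pushforward__canonical__measure_function_Measure leb mf).
rewrite [LHS](_ : _ = m X)//.
apply/esym; apply: lebesgue_measure_unique => // _ [[u v] _ <-] /=.
rewrite /mscale/= /pushforward.
have [an|ap|a0'] := ltgtP a 0; last by rewrite a0' eqxx in a0.
- have -> : (fun x => a * x + b) @^-1` `]u, v]%classic = `[(v - b) / a, (u - b) / a[%classic.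
    apply/seteqP; split => x /=; rewrite !in_itv/= ler_ndivrMr// ltr_ndivlMr// [x * a]mulrC.
      by move=> /andP[? ?]; apply/andP; lra.
    by move=> /andP[? ?]; apply/andP; lra.
  rewrite !lebesgue_measure_itv/= !lte_fin ltr_nM2r ?invr_lt0// ltrD2r.
  case: ifPn => uv; last by rewrite mule0.
  rewrite -!EFinB -EFinM ltr0_norm//; congr EFin; field; exact: a0.
- have -> : (fun x => a * x + b) @^-1` `]u, v]%classic = `](u - b) / a, (v - b) / a]%classic.
    apply/seteqP; split => x /=; rewrite !in_itv/= ler_pdivlMr// ltr_pdivrMr// [x * a]mulrC.
      by move=> /andP[? ?]; apply/andP; lra.
    by move=> /andP[? ?]; apply/andP; lra.
  rewrite !lebesgue_measure_itv/= !lte_fin ltr_pM2r ?invr_gt0// ltrD2r.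
  case: ifPn => uv; last by rewrite mule0.
  rewrite -!EFinB -EFinM gtr0_norm//; congr EFin; field; exact: a0.
Qed.

Section unique.
Context (n : nat).
Local Notation rV := 'rV[R]_n.

Lemma coord_le_norm (x : rV) i : `|x ord0 i| <= `|x|.
Proof.
rewrite [X in _ <= X]mx_normrE.
exact: (le_bigmax _ (fun p : 'I_1 * 'I_n => `|x p.1 p.2|) (ord0, i)).
Qed.

Definition box (A : 'I_n -> set (measurableTypeR R)) : set rV :=
  [set x | forall i, A i (x ord0 i)].

Lemma box_bigcap (A : 'I_n -> set (measurableTypeR R)) :
  box A = \bigcap_(i in [set: 'I_n]) ((fun x : rV => x ord0 i) @^-1` A i).
Proof. by apply/seteqP; split=> [x h i _|x h i]; exact: h. Qed.

Lemma measurable_box (A : 'I_n -> set (measurableTypeR R)) :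
  (forall i, measurable (A i)) -> measurable (box A).
Proof.
move=> mA; rewrite box_bigcap; apply: fin_bigcap_measurable => // i _.
by rewrite -[X in measurable X]setTI; exact: measurable_coor.
Qed.

Lemma lebesgue_box (A : 'I_n -> set (measurableTypeR R)) :
  (forall i, measurable (A i)) ->
  lebesgue_rV n (box A) = (\prod_(i < n) leb (A i))%E.
Proof. exact: lebesgue_rV_box. Qed.

Let boxes : set (set rV) :=
  [set box A | A in [set A | forall i, measurable (A i)]].

(** Boxes, unlike the cylinders that define the sigma-algebra, are stable under
    intersection, as uniqueness of measures requires. *)
Lemma rV_measurableE : @measurable _ rV = <<s boxes >>.
Proof.
apply/seteqP; split.
  apply: smallest_sub; first exact: smallest_sigma_algebra.
  move=> B; rewrite -bigcup_seq => -[i _ [C mC <-]].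
  apply: sub_sigma_algebra.
  exists (fun j => if j == i then C else setT).
    by move=> j /=; case: ifP.
  rewrite setTI; apply/seteqP; split => x; first by move=> /(_ i); rewrite eqxx.
  by move=> Cx j /=; case: eqP => [->|].
apply: smallest_sub; first exact: sigma_algebra_measurable.
by move=> _ [A mA <-]; exact: measurable_box.
Qed.

(** The cubes [-k, k]^n are boxes of finite measure that exhaust the space, so a
    measure is determined by its values on boxes. *)
Lemma lebesgue_rV_unique (m : {measure set rV -> \bar R}) :
  (forall A, (forall i, measurable (A i)) ->
    m (box A) = (\prod_(i < n) leb (A i))%E) ->
  forall B, measurable B -> lebesgue_rV n B = m B.
Proof.
move=> mE B mB.
pose g (k : nat) := box (fun _ => `[(- k%:R : R), k%:R]%classic).
apply: (measure_unique boxes g) => //.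
- exact: rV_measurableE.
- move=> _ _ [A mA <-] [C mC <-]; exists (fun i => A i `&` C i).
    by move=> i; exact: measurableI.
  by apply/seteqP; split=> [x h|x [h1 h2] i //]; split=> i; have [] := h i.
- by move=> k; exists (fun _ => `[(- k%:R : R), k%:R]%classic).
- apply/seteqP; split => // x _.
  have [k xk] : exists k : nat, `|x| < k%:R.
    exists (Num.truncn `|x|).+1; exact: truncnS_gt.
  exists k => // i /=; rewrite in_itv/= -ler_norml.
  exact: le_trans (coord_le_norm x i) (ltW xk).
- by move=> _ [A mA <-]; exact: etrans (lebesgue_box mA) (esym (mE A mA)).
- move=> k; rewrite [X in (X < _)%E](lebesgue_box (A := fun=> `[(- k%:R : R), k%:R]%classic))//.
  have [p pE] : exists p : R, leb `[(- k%:R : R), k%:R]%classic = p%:E.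
    rewrite lebesgue_measure_itv/=; case: ifPn => _; last by exists 0.
    by rewrite -EFinB; eexists.
  under eq_bigr do rewrite pE.
  by rewrite prodEFin ltry.
Qed.

Lemma measurable_rV_affine (a : R) (b : rV) :
  measurable_fun setT (fun x : rV => a *: x + b).
Proof.
apply: measurable_fun_rVP => i; under eq_fun do rewrite !mxE.
apply: measurable_funD => //; apply: measurable_funM => //; exact: measurable_coor.
Qed.

(** The preimage of a box is a box, so the one-dimensional statement applies to
    each factor of the product. *)
Lemma lebesgue_rV_affine (a : R) (b : rV) (B : set rV) :
  a != 0 -> measurable B ->
  ((`|a| ^+ n)%:E * lebesgue_rV n ((fun x => (a *: x + b)%R) @^-1` B))%E = lebesgue_rV n B.
Proof.
move=> a0 mB.
have an0 : 0 <= `|a| ^+ n by rewrite exprn_ge0.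
pose m : {measure set rV -> \bar R} :=
  mscale (NngNum an0)
    (measure_function_pushforward__canonical__measure_function_Measure
       (lebesgue_rV n) (measurable_rV_affine a b)).
rewrite [LHS](_ : _ = m B)//.
apply/esym; apply: lebesgue_rV_unique => // A mA /=.
rewrite /mscale/= /pushforward.
rewrite [X in lebesgue_rV n X](_ : _ =
    box (fun i => (fun x => a * x + b ord0 i) @^-1` A i)); last first.
  by apply/seteqP; split => x h i; have := h i; rewrite /= !mxE.
have mf i : measurable_fun setT
    (fun x : measurableTypeR R => a * x + b ord0 i : measurableTypeR R).
  exact: measurable_funD.
rewrite lebesgue_box; last first.
  by move=> i; rewrite -[X in measurable X]setTI; exact: mf.
under [RHS]eq_bigr => i _ do rewrite -(lebesgue_measure_affine (b ord0 i) a0)//.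
rewrite big_split/=; congr (_ * _)%E.
by rewrite prodEFin prodr_const card_ord.
Qed.
End unique.
End affine.

(** * Continuous functions and the integral of a directional derivative *)

Section continuity.
Context {R : realType} {n : nat}.
Local Notation rV := 'rV[R]_n.
Local Notation mu := (lebesgue_rV n : {measure set 'rV[R]_n -> \bar R}).

Lemma rV_ballE (x y : rV) e : ball x e y <-> `|x - y| < e.
Proof. by rewrite mx_norm_ball. Qed.

Lemma norm_rV_lt (x : rV) (e : R) : 0 < e ->
  (forall i, `|x ord0 i| < e) -> `|x| < e.
Proof.
move=> e0 h; rewrite [X in X < _]mx_normrE.
by apply: bigmax_lt => // -[i j] _ /=; rewrite ord1.
Qed.

(** The sigma-algebra is the one generated by the coordinates.  An open set is a
    union of boxes with rational centres and radii 1/(m+1), and there are only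
    countably many of these. *)
Lemma open_rV_measurable (U : set rV) : open U -> measurable U.
Proof.
move=> oU.
pose F (p : 'rV[rat]_n * nat) : set rV :=
  box (fun i => ball (ratr (p.1 ord0 i) : R) p.2.+1%:R^-1).
have mF p : measurable (F p).
  by apply: measurable_box => i; exact: measurable_ball.
pose G p := if `[< F p `<=` U >] then F p else set0.
have -> : U = \bigcup_(p in [set: 'rV[rat]_n * nat]) G p.
  apply/seteqP; split; last first.
    by move=> x [p _]; rewrite /G; case: asboolP => // FU /FU.
  move=> x Ux.
  have /nbhs_ballP[e /= e0 eU] : nbhs x U by exact: open_nbhs_nbhs.
  have [m me] : exists m : nat, m.+1%:R^-1 < e / 2 :> R.
    exists (Num.truncn (e / 2)^-1).
    by rewrite invf_plt ?posrE ?divr_gt0// truncnS_gt.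
  have m0 : 0 < m.+1%:R^-1 :> R by [].
  have [q qE] : {q : 'rV[rat]_n | forall i, `|ratr (q ord0 i) - x ord0 i| < m.+1%:R^-1}.
    have ex i : exists q : rat, `|ratr q - x ord0 i| < m.+1%:R^-1.
      have [|q] := @rat_in_itvoo R (x ord0 i) (x ord0 i + m.+1%:R^-1).
        by rewrite ltrDl.
      rewrite in_itv/= => /andP[q1 q2]; exists q.
      by rewrite ger0_norm ?subr_ge0 1?ltW// ltrBlDl.
    exists (\row_(j < n) sval (cid (ex j))) => i; rewrite mxE.
    exact: svalP (cid (ex i)).
  exists (q, m) => //; rewrite /G ifT; last first.
    apply/asboolP => y Fy; apply: eU; apply/rV_ballE; apply: norm_rV_lt => // i.
    rewrite !mxE; have h1 := qE i.
    have h2 : `|ratr (q ord0 i) - y ord0 i| < m.+1%:R^-1 := Fy i.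
    rewrite (le_lt_trans (ler_distD (ratr (q ord0 i)) _ _))//.
    rewrite (splitr e) ltrD//; last exact: lt_trans h2 me.
    by rewrite distrC; exact: lt_trans h1 me.
  by move=> i /=; exact: qE.
apply: countable_bigcupT_measurable => [|p]; first exact: countableP.
by rewrite /G; case: ifP.
Qed.

Lemma continuous_measurable_rV (f : rV -> R) :
  continuous f -> measurable_fun setT (f : rV -> measurableTypeR R).
Proof.
move=> /continuousP cf; apply: (measurability _ (RGenOpens.measurableE R)).
move=> _ [_ [a [b ->] <-]]; rewrite setTI.
by apply: open_rV_measurable; exact/cf/interval_open.
Qed.

Definition cube (L : R) : set rV := [set x | `|x| <= L].

Lemma continuous_norm_rV : continuous (fun x : rV => `|x|).
Proof. by move=> x; exact: norm_continuous. Qed.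

Lemma closed_cube L : closed (cube L).
Proof.
rewrite (_ : cube L = (fun x : rV => `|x|) @^-1` [set y | y <= L])//.
apply: preimage_closed; last exact: closed_le.
by move=> x _; exact: continuous_norm_rV.
Qed.

Lemma compact_cube L : compact (cube L).
Proof.
apply: bounded_closed_compact; last exact: closed_cube.
exists L; split; first exact: num_real.
by move=> M LM x /=; rewrite /cube/= => /le_trans; apply; exact: ltW.
Qed.

Lemma measurable_cube L : measurable (cube L).
Proof.
rewrite -[cube L]setCK; apply: measurableC; apply: open_rV_measurable.
by rewrite openC; exact: closed_cube.
Qed.

Lemma lebesgue_cube_lty L : (mu (cube L) < +oo)%E.
Proof.
apply: (@le_lt_trans _ _ (mu (box (fun=> `[- L, L]%classic)))).
  apply: le_measure; rewrite ?inE.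
  - exact: measurable_cube.
  - exact: measurable_box.
  - move=> x xL i /=; rewrite in_itv/= -ler_norml.
    exact: le_trans (coord_le_norm x i) xL.
rewrite [X in (X < _)%E](lebesgue_box (A := fun=> `[- L, L]%classic))//.
have [p pE] : exists p : R, lebesgue_measure `[- L, L]%classic = p%:E.
  rewrite lebesgue_measure_itv/=; case: ifPn => _; last by exists 0.
  by rewrite -EFinB; eexists.
under eq_bigr do rewrite pE.
by rewrite prodEFin ltry.
Qed.

Lemma integrable_vanishing (D : set rV) (f : rV -> R) (M : R) :
  measurable D -> (mu D < +oo)%E ->
  measurable_fun setT (f : rV -> measurableTypeR R) ->
  (forall x, `|f x| <= M) -> (forall x, ~ D x -> f x = 0) ->
  mu.-integrable setT (EFin \o f).
Proof.
move=> mD Doo mf fM f0.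
have -> : EFin \o f = (EFin \o f) \_ D.
  apply/funext => x; rewrite patchE; case: ifPn => // /negP; rewrite inE => nD.
  by rewrite /= f0.
apply/(integrable_mkcond _ mD); apply: measurable_bounded_integrable => //.
  exact: measurable_funTS.
exists M; split; first exact: num_real.
by move=> N MN x Dx /=; exact: le_trans (fM x) (ltW MN).
Qed.

Lemma continuous_vanishing_bounded (f : rV -> R) L :
  continuous f -> (forall x, L < `|x| -> f x = 0) ->
  exists2 M, 0 <= M & forall x, `|f x| <= M.
Proof.
move=> cf f0.
have : compact (f @` cube L).
  apply: continuous_compact (@compact_cube L).
  exact: continuous_subspaceT.
move=> /compact_bounded[M [_ fM]]; exists (`|M| + 1); first by rewrite addr_ge0.
move=> x; have [xL|xL] := leP `|x| L; last by rewrite f0// normr0 addr_ge0.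
apply: fM; first by rewrite ltr_pwDr// ler_norm.
by exists x.
Qed.

Lemma integrable_continuous_vanishing (f : rV -> R) L :
  continuous f -> (forall x, L < `|x| -> f x = 0) ->
  mu.-integrable setT (EFin \o f).
Proof.
move=> cf f0; have [M _ fM] := continuous_vanishing_bounded cf f0.
apply: (integrable_vanishing (measurable_cube L) (lebesgue_cube_lty L) _ fM).
  exact: continuous_measurable_rV.
by move=> x /= /negP; rewrite -ltNge => /f0.
Qed.

(** The case |a| = 1, where the Jacobian is 1: translations and the reflection
    x |-> - x. *)
Lemma integral_rV_affine (a : R) (b : rV) (D : set rV) (f : rV -> \bar R) :
  `|a| = 1 -> measurable D -> measurable_fun setT f ->
  mu.-integrable ((fun x => a *: x + b) @^-1` D) (fun x => f (a *: x + b)) ->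
  (\int[mu]_(x in D) f x =
   \int[mu]_(x in (fun x => (a *: x + b)%R) @^-1` D) f (a *: x + b)%R)%E.
Proof.
move=> a1 mD mf fi.
rewrite -(integral_pushforward (measurable_rV_affine a b) mf fi mD).
apply: eq_measure_integral; first exact: measurable_rV_affine.
move=> mf' A mA AD.
have a0 : a != 0 by rewrite -normr_eq0 a1 oner_eq0.
rewrite -[LHS](lebesgue_rV_affine b a0 mA) a1.
by rewrite expr1n mul1e.
Qed.

End continuity.

Section directional.
Context {R : realType} {n : nat}.
Local Notation rV := 'rV[R]_n.
Local Notation mu := (lebesgue_rV n : {measure set 'rV[R]_n -> \bar R}).

(** The one-dimensional mean value theorem is applied on lines. *)
Lemma is_derive_line (f : rV -> R) (x v : rV) (t df : R) :
  is_derive (t *: v + x) v f df ->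
  is_derive t 1 (fun s : R => f (s *: v + x)) df.
Proof.
move=> [/= dfx fE].
have eqq : (fun h : R => h^-1 *: (f ((h *: 1 + t) *: v + x) - f (t *: v + x)))
  = (fun h : R => h^-1 *: (f (h *: v + (t *: v + x)) - f (t *: v + x))).
  by apply/funext => h; rewrite scalerDl addrA [_%:A]mulr1.
split; first by rewrite /derivable/= eqq.
by rewrite -fE /derive /= eqq.
Qed.

(** By translation invariance the difference quotients of [psi] in the direction
    [v] have integral zero.  They converge pointwise to [g], and by the mean
    value theorem they are dominated by the bound of [g] on one fixed cube. *)
Lemma integral_directional_derivative_eq0 (psi g : rV -> R) (v : rV) (L : R) :
  continuous psi -> continuous g -> (forall x, is_derive x v psi (g x)) ->
  (forall x, L < `|x| -> psi x = 0 /\ g x = 0) ->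
  (\int[mu]_x (g x)%:E = 0)%E.
Proof.
move=> cpsi cg dpsi vanish.
have [M M0 gM] := continuous_vanishing_bounded cg (fun x h => (vanish x h).2).
pose h (k : nat) : R := k.+1%:R^-1.
have h0 k : 0 < h k by rewrite /h invr_gt0.
have h1 k : h k <= 1 by rewrite /h invf_le1// ler1n.
pose q (k : nat) (x : rV) : R := (h k)^-1 * (psi (h k *: v + x) - psi x).
have cshift k : continuous (fun x => psi (h k *: v + x)).
  move=> x; apply: (@continuous_comp _ _ _ (fun x => h k *: v + x) psi).
    by apply: continuousD; [exact: cst_continuous|exact: cvg_id].
  exact: cpsi.
have int_psi := integrable_continuous_vanishing cpsi (fun x h => (vanish x h).1).
(* A step is at most [v], as h k <= 1: all the quotients vanish outside the
   cube of size L + |v|. *)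
have far k x : L + `|v| < `|x| -> L < `|h k *: v + x|.
  move=> Lx; have : `|x| <= `|h k *: v + x| + `|h k *: v|.
    have := ler_normB (h k *: v + x) (h k *: v).
    by rewrite [X in `|X|]addrAC subrr add0r.
  have : `|h k *: v| <= `|v|.
    by rewrite normrZ gtr0_norm// ler_piMl.
  lra.
have int_shift k : mu.-integrable setT (fun x => (psi (h k *: v + x))%:E).
  apply: (integrable_continuous_vanishing (L := L + `|v|) (cshift k)) => x Lx.
  exact: (vanish _ (far k x Lx)).1.
have int_q k : (\int[mu]_x (q k x)%:E = 0)%E.
  rewrite /q; under eq_integral do rewrite EFinM.
  rewrite integralZl//; last first.
    by under eq_fun do rewrite EFinB; exact: integrableB (int_shift k) int_psi.
  under eq_integral do rewrite EFinB.
  rewrite integralB//.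
  rewrite [X in (_ * (_ - X))%E](integral_rV_affine (a := 1) (b := h k *: v)) ?normr1//.
  - rewrite preimage_setT; under [X in (_ * (_ - X))%E]eq_integral do rewrite scale1r addrC.
    rewrite subee ?mule0//; apply: integrable_fin_num => //; exact: int_shift.
  - exact: measurable_int int_psi.
  - by rewrite preimage_setT; under eq_fun do rewrite scale1r addrC; exact: int_shift.
have q_bound k x : `|q k x| <= M.
  rewrite /q.
  have [|c _] := @MVT_segment R (fun t => psi (t *: v + x))
     (fun t => g (t *: v + x)) 0 (h k) (ltW (h0 k))
     (fun t _ => is_derive_line (dpsi _)).
    apply: continuous_subspaceT => t.
    apply: (@continuous_comp _ _ _ (fun t : R => t *: v + x) psi); last exact: cpsi.
    apply: continuousD; last exact: cst_continuous.
    exact: scalel_continuous.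
  rewrite scale0r add0r subr0 => ->.
  by rewrite mulrCA mulVf ?gt_eqF// mulr1.
have q_far k x : ~ cube (L + `|v|) x -> q k x = 0.
  move=> /= /negP; rewrite -ltNge => Lx; rewrite /q.
  rewrite (vanish _ (far k x Lx)).1 (vanish x _).1 ?subrr ?mulr0//.
  by rewrite (le_lt_trans _ Lx)// lerDl.
pose dom := fun x : rV => (M * \1_(cube (L + `|v|)) x)%:E.
have mcube := @measurable_cube R n (L + `|v|).
have idom : mu.-integrable setT dom.
  apply: (integrable_vanishing (M := M) mcube (lebesgue_cube_lty _)).
  - apply: measurable_funM => //; exact: measurable_indic.
  - move=> x; rewrite indicE; case: (x \in _); rewrite ?mulr1 ?mulr0 ?normr0//.
    by rewrite ger0_norm.
  - by move=> x nx; rewrite indicE memNset// mulr0.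
have [||||_ _] := @dominated_convergence _ _ R mu setT measurableT
   (fun k x => (q k x)%:E) (fun x => (g x)%:E) dom _ _ _ idom.
- move=> k; apply/measurable_EFinP; apply: measurable_funM => //.
  apply: measurable_funB; exact: continuous_measurable_rV.
- by apply/measurable_EFinP; exact: continuous_measurable_rV.
- apply: aeW => x _; apply: cvg_EFin; first by apply: nearW.
  have [/= dx <-] := dpsi x.
  have := dx; rewrite /derivable => /cvgr_dnbhsP.
  apply; split; first by move=> k; rewrite gt_eqF.
  exact: cvg_harmonic.
- apply: aeW => x k _; rewrite /dom abse_EFin lee_fin.
  have [xL|xL] := pselect (cube (L + `|v|) x).
    by rewrite indicE mem_set// mulr1.
  by rewrite q_far// normr0 indicE memNset// mulr0.
under eq_fun do rewrite int_q.
by move/cvg_lim => <-//; rewrite lim_cst.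
Qed.

End directional.

(** * Square integrable functions *)

Section L2.
Context {R : realType} {n : nat}.
Local Notation rV := 'rV[R]_n.
Local Notation mu := (lebesgue_rV n : {measure set 'rV[R]_n -> \bar R}).
Variable Omega : set 'rV[R]_n.
Hypothesis mOmega : measurable Omega.

Lemma sqr_poweR (x : \bar R) : (0 <= x)%E -> (x ^+ 2)%E = (x `^ 2)%E.
Proof.
case: x => [x|_|//].
  by rewrite lee_fin => x0; rewrite poweR_EFin expe2 -EFinM -expr2 -powR_mulrn.
by rewrite expe2 poweRyr ?mulyy.
Qed.

Lemma L2norm_sqrE (u : rV -> R) :
  (L2norm Omega u ^+ 2)%E = (\int[mu]_(x in Omega) (u x ^+ 2)%:E)%E.
Proof.
rewrite sqr_poweR ?Lnorm_ge0// /L2norm poweR_Lnorm// [RHS]integral_mkcond.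
apply: eq_integral => x _; rewrite [RHS]patchE /= patchE.
case: ifPn => _.
  by rewrite powR_mulrn// real_normK ?num_real.
by rewrite normr0 powR0.
Qed.

(** The products, sums and bounds below are all read off this description. *)
Lemma in_L2P (u : rV -> R) : in_L2 Omega u <->
  measurable_fun Omega (u : rV -> measurableTypeR R) /\
  mu.-integrable Omega (fun x => (u x ^+ 2)%:E).
Proof.
rewrite /in_L2; split.
  rewrite inE => /andP[]; rewrite inE/= => mu' fu.
  have mu0 : measurable_fun Omega (u : rV -> measurableTypeR R).
    exact/(measurable_restrictT _ mOmega).
  split => //; apply/integrableP; split.
    by apply/measurable_EFinP; exact: measurable_funX.
  under eq_integral do rewrite gee0_abs ?lee_fin ?sqr_ge0//.
  rewrite -L2norm_sqrE expe2.
  by move: fu; rewrite inE => fu; rewrite lte_mul_pinfty ?Lnorm_ge0// ge0_fin_numE ?Lnorm_ge0.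
move=> [mu0 iu]; rewrite inE; apply/andP; rewrite !inE/=; split.
  exact/(measurable_restrictT _ mOmega).
have : (L2norm Omega u ^+ 2 < +oo)%E.
  rewrite L2norm_sqrE; move/integrableP : iu => [_].
  by under eq_integral do rewrite gee0_abs ?lee_fin ?sqr_ge0//.
rewrite /finite_norm -/(L2norm Omega u).
have : (0 <= L2norm Omega u)%E by exact: Lnorm_ge0.
by case: (L2norm Omega u) => [r| |]; rewrite ?ltry// expe2 mulyy.
Qed.

Lemma in_L2_measurable (u : rV -> R) : in_L2 Omega u ->
  measurable_fun Omega (u : rV -> measurableTypeR R).
Proof. by move=> /in_L2P[]. Qed.

Lemma in_L2_mul_integrable (u w : rV -> R) : in_L2 Omega u -> in_L2 Omega w ->
  mu.-integrable Omega (EFin \o (fun x => u x * w x)).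
Proof.
move=> /in_L2P[mu0 iu] /in_L2P[mw iw].
apply: (le_integrable mOmega _ _ (integrableD mOmega iu iw)).
  by apply/measurable_EFinP; exact: measurable_funM.
move=> x _ /=; rewrite lee_fin [leRHS]ger0_norm ?addr_ge0 ?sqr_ge0//.
rewrite ler_norml; apply/andP; split; nra.
Qed.

Lemma in_L2Z (a : R) (u : rV -> R) : in_L2 Omega u -> in_L2 Omega (fun x => a * u x).
Proof.
move=> /in_L2P[mu0 iu]; apply/in_L2P; split; first exact: measurable_funM.
under eq_fun do rewrite exprMn EFinM.
exact: integrableZl.
Qed.

Lemma in_L2D (u w : rV -> R) : in_L2 Omega u -> in_L2 Omega w ->
  in_L2 Omega (fun x => u x + w x).
Proof.
move=> Lu Lw; have [mu0 iu] := (in_L2P u).1 Lu; have [mw iw] := (in_L2P w).1 Lw.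
apply/in_L2P; split; first exact: measurable_funD.
under eq_fun do rewrite sqrrD mulr2n !EFinD.
have iuw := in_L2_mul_integrable Lu Lw.
by apply: integrableD => //; apply: integrableD => //; exact: integrableD.
Qed.

Lemma in_L2B (u w : rV -> R) : in_L2 Omega u -> in_L2 Omega w ->
  in_L2 Omega (fun x => u x - w x).
Proof.
move=> Lu Lw; have := in_L2D Lu (in_L2Z (-1) Lw).
by under eq_fun do rewrite mulN1r.
Qed.

Lemma in_L2_fin_num (u : rV -> R) : in_L2 Omega u -> L2norm Omega u \is a fin_num.
Proof.
rewrite /in_L2 inE => /andP[_]; rewrite inE/= /finite_norm => fu.
by rewrite ge0_fin_numE ?Lnorm_ge0.
Qed.

Lemma in_L2_sqr (u : rV -> R) : in_L2 Omega u ->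
  (L2norm Omega u ^+ 2)%E = (\int[mu]_(x in Omega) (u x * u x))%:E.
Proof.
move=> Lu; rewrite L2norm_sqrE /Rintegral fineK.
  by apply: eq_integral => x _; rewrite expr2.
by apply: integrable_fin_num => //; exact: in_L2_mul_integrable.
Qed.

Lemma L2_cauchy_schwarz (u w : rV -> R) : in_L2 Omega u -> in_L2 Omega w ->
  `|\int[mu]_(x in Omega) (u x * w x)| <=
    fine (L2norm Omega u) * fine (L2norm Omega w).
Proof.
move=> Lu Lw; have iuw := in_L2_mul_integrable Lu Lw.
rewrite -lee_fin EFinM !fineK ?in_L2_fin_num//.
rewrite EFin_normr_Rintegral//.
apply: (le_trans (le_abse_integral _ mOmega _)).
  exact: measurable_int iuw.
have H : ('N[mu]_1[EFin \o ((u \_ Omega) \* (w \_ Omega))%R] <=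
 L2norm Omega u * L2norm Omega w)%E.
  apply: hoelder => //; try by apply/(measurable_restrictT _ mOmega); exact: in_L2_measurable.
  lra.
apply: le_trans H; rewrite Lnorm1 integral_mkcond.
rewrite le_eqVlt; apply/orP; left; apply/eqP; apply: eq_integral => x _ /=.
by rewrite !patchE; case: ifPn => // _; rewrite mulr0 normr0.
Qed.

Lemma in_L2_bounded (u : rV -> R) (C : R) : (mu Omega < +oo)%E ->
  measurable_fun Omega (u : rV -> measurableTypeR R) ->
  (forall x, Omega x -> `|u x| <= C) -> in_L2 Omega u.
Proof.
move=> Ooo mu0 uC; apply/in_L2P; split => //.
apply: measurable_bounded_integrable => //; first exact: measurable_funX.
exists (C ^+ 2); split; first exact: num_real.
move=> N CN x Ox /=; apply: le_trans (ltW CN).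
by rewrite normrX lerXn2r ?nnegrE ?uC// (le_trans _ (uC _ Ox)).
Qed.

Lemma in_L2_continuous_vanishing (u : rV -> R) (L : R) :
  continuous u -> (forall x, L < `|x| -> u x = 0) -> in_L2 Omega u.
Proof.
move=> cu u0; apply/in_L2P; split.
  by apply: measurable_funTS; exact: continuous_measurable_rV.
apply: (integrableS measurableT) => //.
apply: (@integrable_continuous_vanishing _ _ (fun x => u x ^+ 2) L).
  move=> x; rewrite (_ : (fun x => u x ^+ 2) = u * u); last exact/funext.
  by apply: continuousM; exact: cu.
by move=> x /u0 ->; rewrite expr0n.
Qed.

Lemma Rintegral_sum (I : Type) (s : seq I) (f : I -> rV -> R) :
  (forall i, mu.-integrable Omega (EFin \o f i)) ->
  \int[mu]_(x in Omega) (\sum_(i <- s) f i x) =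
  \sum_(i <- s) \int[mu]_(x in Omega) f i x.
Proof.
move=> fi; rewrite /Rintegral.
under eq_integral do rewrite -sumEFin.
rewrite (integral_sum mOmega (f := fun i x => (f i x)%:E))//.
rewrite -sum_fine// => i _.
by apply: integrable_fin_num => //; exact: fi.
Qed.

End L2.

(** * Duality: lower bounds for the Bogovskii constant *)

Section duality.
Context {R : realType} {n : nat}.
Local Notation rV := 'rV[R]_n.
Local Notation mu := (lebesgue_rV n : {measure set 'rV[R]_n -> \bar R}).
Variable Omega : set 'rV[R]_n.
Hypothesis mOmega : measurable Omega.

(** The complement of the support is open, so the values and the derivatives of
    [phi] vanish there. *)
Lemma notin_supp_near0 (phi : rV -> R) x : ~ supp phi x -> \near x, phi x = 0.
Proof.
move=> nx; have : nbhs x (~` supp phi).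
  by apply: open_nbhs_nbhs; split => //; rewrite openC; exact: closed_closure.
apply: filterS => y ny; apply/eqP; apply: contra_notT ny => phiy.
exact: subset_closure.
Qed.

Lemma partial_notin_supp (phi : rV -> R) j x :
  ~ supp phi x -> partial j phi x = 0.
Proof.
move=> /notin_supp_near0 nx; apply: derive_val.
by apply: (near_eq_is_derive (f := cst 0)); near=> y; rewrite (near nx y).
Unshelve. all: by end_near.
Qed.

Lemma test_function_far (phi : rV -> R) : test_function Omega phi ->
  exists L, forall x, L < `|x| -> ~ supp phi x.
Proof.
move=> [_ /compact_bounded[L [_ cphi]] _]; exists (L + 1) => x Lx sx.
have L1 : L < L + 1 by rewrite ltrDl.
by have /= := cphi _ L1 x sx; rewrite leNgt Lx.
Qed.

Lemma notin_supp_eq0 (phi : rV -> R) x : ~ supp phi x -> phi x = 0.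
Proof. by move=> /notin_supp_near0/nbhs_singleton. Qed.

Lemma test_function_partial_in_L2 (phi : rV -> R) j :
  test_function Omega phi -> in_L2 Omega (partial j phi).
Proof.
move=> tphi; have [L far] := test_function_far tphi.
have [smooth_phi _ _] := tphi.
apply: (in_L2_continuous_vanishing mOmega (L := L)).
  exact: (smooth_phi [:: j]).1.
by move=> x /far; exact: partial_notin_supp.
Qed.

Lemma L2_pairing_cvg (m h : rV -> R) (h_ : nat -> rV -> R) :
  in_L2 Omega m -> in_L2 Omega h -> (forall k, in_L2 Omega (h_ k)) ->
  L2norm Omega (fun x => h_ k x - h x) @[k --> \oo] --> 0%E ->
  \int[mu]_(x in Omega) (m x * h_ k x) @[k --> \oo] -->
    \int[mu]_(x in Omega) (m x * h x).
Proof.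
move=> Lm Lh Lh_ /fine_cvg hcvg; apply/subr_cvg0; apply: norm_cvg0.
apply: (@squeeze_cvgr _ _ _ _ (cst 0) (fun k => fine (L2norm Omega m) *
  fine (L2norm Omega (fun x => h_ k x - h x)))).
- apply: nearW => k; rewrite normr_ge0/=.
  rewrite -RintegralB//; try exact: in_L2_mul_integrable.
  under eq_Rintegral do rewrite -mulrBr.
  by apply: L2_cauchy_schwarz => //; exact: in_L2B.
- exact: cvg_cst.
- rewrite -[X in _ --> X](mulr0 (fine (L2norm Omega m))).
  by apply: cvgM hcvg; exact: cvg_cst.
Qed.

(** Distributional form of d_i f = div m: both sides are tested against [phi] and
    the common sign of the integrations by parts is dropped. *)
Definition weak_dual_field (f : rV -> R) (i : 'I_n) (m : 'I_n -> rV -> R) : Prop :=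
  forall phi, test_function Omega phi ->
    \int[mu]_(x in Omega) (f x * partial i phi x) =
    \sum_(j < n) \int[mu]_(x in Omega) (m j x * partial j phi x).

(** Only gradients appear in the identity, and the gradients of the test
    functions that approximate [u] converge in L^2 to [g]. *)
Lemma weak_dual_field_H10 (f : rV -> R) i (m : 'I_n -> rV -> R)
    (u : rV -> R) (g : rV -> rV) :
  in_L2 Omega f -> (forall j, in_L2 Omega (m j)) -> weak_dual_field f i m ->
  in_H10 Omega u g ->
  \int[mu]_(x in Omega) (f x * g x ord0 i) =
  \sum_(j < n) \int[mu]_(x in Omega) (m j x * g x ord0 j).
Proof.
move=> Lf Lm dual [[_ Lg _] [phi_ [tphi _ phig]]].
have pairing (w : rV -> R) j : in_L2 Omega w ->
    \int[mu]_(x in Omega) (w x * partial j (phi_ k) x) @[k --> \oo] -->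
    \int[mu]_(x in Omega) (w x * g x ord0 j).
  move=> Lw; apply: L2_pairing_cvg => // k.
  exact: test_function_partial_in_L2.
have lhs := pairing f i Lf.
have rhs : \sum_(j < n) \int[mu]_(x in Omega) (m j x * partial j (phi_ k) x)
    @[k --> \oo] --> \sum_(j < n) \int[mu]_(x in Omega) (m j x * g x ord0 j).
  by apply: cvg_big => [|j _]; [exact: add_continuous|exact: pairing].
rewrite (_ : (fun k => _) = fun k => \int[mu]_(x in Omega) (f x * partial i (phi_ k) x)) in rhs.
  exact: (cvg_unique _ lhs rhs).
by apply/funext => k; rewrite dual.
Qed.

Variables (f : rV -> R) (M : 'I_n -> 'I_n -> rV -> R) (K : R).
Hypotheses (Lf : in_L2 Omega f) (LM : forall i j, in_L2 Omega (M i j)).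
Hypothesis dualM : forall i, weak_dual_field f i (M i).
Hypothesis K0 : 0 < K.
Hypothesis MK :
  \sum_(i < n) \sum_(j < n) \int[mu]_(x in Omega) (M i j x * M i j x) <= K.

Local Notation F := (\int[mu]_(x in Omega) (f x * f x)).

(** With S = l int f^2 = int M : G, expand 0 <= int |G - t M|^2 for
    t = S / K; this value of t maximises 2 t S - t^2 K, a lower bound for
    int |G|^2. *)
Lemma dirichlet_lower_bound (l : R) (v : rV -> rV) (G : rV -> 'M[R]_n) :
  in_H10_vec Omega v G -> div_eq Omega G (fun x => l * f x) ->
  (((l * F) ^+ 2 / K)%:E <= dirichlet Omega G)%E.
Proof.
move=> vG divG.
have LG i j : in_L2 Omega (fun x => G x i j).
  have [[_ /(_ j) + _] _] := vG i.
  by rewrite (_ : (fun x => row i (G x) ord0 j) = fun x => G x i j)//; apply/funext => x; rewrite mxE.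
have -> : dirichlet Omega G =
    (\sum_(i < n) \sum_(j < n) \int[mu]_(x in Omega) (G x i j * G x i j))%:E.
  rewrite /dirichlet -sumEFin; apply: eq_bigr => i _.
  by rewrite -sumEFin; apply: eq_bigr => j _; rewrite in_L2_sqr.
have ifG i : mu.-integrable Omega (EFin \o (fun x => f x * G x i i)).
  exact: in_L2_mul_integrable.
have lFE : l * F = \sum_(i < n) \sum_(j < n)
    \int[mu]_(x in Omega) (M i j x * G x i j).
  transitivity (\int[mu]_(x in Omega) (f x * \tr (G x))).
    rewrite -RintegralZl//; last exact: in_L2_mul_integrable.
    congr fine; apply: ae_eq_integral => //.
    - apply/measurable_EFinP; apply: measurable_funM => //.
      by apply: measurable_funM; exact: in_L2_measurable.
    - apply/measurable_EFinP; apply: measurable_funM; first exact: in_L2_measurable.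
      apply: measurable_sum => i; exact: in_L2_measurable.
    - apply: filterS divG => x + Ox => /(_ Ox) ->; congr EFin; ring.
  under eq_Rintegral do rewrite mulr_sumr.
  rewrite Rintegral_sum//; apply: eq_bigr => i _.
  have := weak_dual_field_H10 Lf (LM i) (dualM i) (vG i).
  under eq_Rintegral do rewrite mxE.
  move=> ->; apply: eq_bigr => j _; apply: eq_Rintegral => x _.
  by rewrite mxE.
set D := \sum_(i < n) _; set S := l * F in lFE *.
pose t := S / K.
have : 0 <= \sum_(i < n) \sum_(j < n) \int[mu]_(x in Omega)
    ((G x i j - t * M i j x) * (G x i j - t * M i j x)).
  apply: sumr_ge0 => i _; apply: sumr_ge0 => j _.
  by apply: Rintegral_ge0 => x _; rewrite -expr2 sqr_ge0.
have expand i j : \int[mu]_(x in Omega)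
      ((G x i j - t * M i j x) * (G x i j - t * M i j x)) =
    \int[mu]_(x in Omega) (G x i j * G x i j)
    - 2 * t * \int[mu]_(x in Omega) (M i j x * G x i j)
    + t ^+ 2 * \int[mu]_(x in Omega) (M i j x * M i j x).
  have iGG := in_L2_mul_integrable mOmega (LG i j) (LG i j).
  have iMG := in_L2_mul_integrable mOmega (LM i j) (LG i j).
  have iMM := in_L2_mul_integrable mOmega (LM i j) (LM i j).
  rewrite -!RintegralZl//.
  rewrite -RintegralB//; last exact: (integrableZl mOmega (2 * t) iMG).
  rewrite -RintegralD//; last 2 first.
  - exact: (integrableB mOmega iGG (integrableZl mOmega (2 * t) iMG)).
  - exact: (integrableZl mOmega (t ^+ 2) iMM).
  by apply: eq_Rintegral => x _; ring.
under eq_bigr do (under eq_bigr do rewrite expand; rewrite big_split sumrB -!mulr_sumr).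
rewrite big_split sumrB -!mulr_sumr/= -/D -lFE.
set N := (X in _ + _ * X) => ge0.
have : t ^+ 2 * N <= t ^+ 2 * K by rewrite ler_wpM2l ?sqr_ge0.
have tK : t * K = S by rewrite /t divfK// gt_eqF.
rewrite lee_fin -(_ : t * S = S ^+ 2 / K); last by rewrite /t; ring.
have : t ^+ 2 * K = t * S by rewrite expr2 -mulrA tK.
move: ge0; lra.
Qed.

(** Duality bound: the competitor in the supremum is f divided by its norm. *)
Lemma bogovskii_constant_ge : 0 < F -> \int[mu]_(x in Omega) f x = 0 ->
  mu.-integrable Omega (EFin \o f) ->
  ((F / K)%:E <= bogovskii_constant Omega)%E.
Proof.
move=> F0 intf if0; pose l := (Num.sqrt F)^-1.
have l2 : l ^+ 2 * F = 1.
  by rewrite /l exprVn sqr_sqrtr ?ltW// mulVf// gt_eqF.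
pose h x := l * f x.
have Lh : in_L2 Omega h by exact: in_L2Z.
apply: (@le_trans _ _ (ereal_inf [set dirichlet Omega G | G in
   [set G | exists v, in_H10_vec Omega v G /\ div_eq Omega G h]])); last first.
  apply: ereal_sup_ubound; exists h => //; split.
    split => //; rewrite /h; under eq_integral do rewrite EFinM.
    rewrite integralZl//; move: intf => /eqP; rewrite /Rintegral fine_eq0; last exact: integrable_fin_num.
    by move=> /eqP ->; rewrite mule0.
  have : (L2norm Omega h ^+ 2)%E = 1%E.
    rewrite in_L2_sqr//; congr EFin; rewrite -l2 -RintegralZl//; last exact: in_L2_mul_integrable.
    by apply: eq_Rintegral => x _; rewrite /h; ring.
  have : (0 <= L2norm Omega h)%E by exact: Lnorm_ge0.
  have := in_L2_fin_num Lh; case: (L2norm Omega h) => [r _| |]//.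
  rewrite lee_fin expe2 -EFinM -expr2 => r0 [] /eqP.
  by rewrite sqrf_eq1 => /orP[/eqP ->//|/eqP rE]; exfalso; move: r0; rewrite rE; lra.
apply: le_ereal_inf_tmp => _ [G [v [vG divG]] <-].
apply: le_trans (dirichlet_lower_bound vG divG).
rewrite lee_fin le_eqVlt; apply/orP; left; apply/eqP; congr (_ / _).
by rewrite exprMn expr2 [F ^+ 2]expr2 mulrA -expr2 l2 mul1r.
Qed.

End duality.

(** * Derivatives of radial functions and integration by parts *)

Section chain.
Context {R : realType} {n : nat}.
Local Notation rV := 'rV[R]_n.

(** A directional derivative is a derivative along a line; this reduces the chain
    rule below to the one-variable chain rule. *)
Lemma is_derive_lineP (f : rV -> R) (x v : rV) (df : R) :
  is_derive x v f df <-> is_derive (0 : R) (1 : R) (fun s : R => f (s *: v + x)) df.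
Proof.
split=> [fx|[/= d1 d2]]; first by apply: is_derive_line; rewrite scale0r add0r.
pose F (s : R) : R := f (s *: v + x).
have eqq : (fun h : R => h^-1 *: (f (h *: v + x) - f x)) =
  (fun h : R => h^-1 *: (F (h *: 1 + 0) - F 0)).
  by apply/funext => h; rewrite /F/= addr0 scale0r add0r [_%:A]mulr1.
by split; [rewrite /derivable eqq|rewrite /derive eqq].
Qed.

Lemma is_derive_comp_real (f : rV -> R) (g : R -> R) (x v : rV) (df dg : R) :
  is_derive x v f df -> is_derive (f x) 1 g dg ->
  is_derive x v (g \o f) (dg * df).
Proof.
move=> /is_derive_lineP df1 dg1; apply/is_derive_lineP.
apply: (@is_derive1_comp _ g (fun s => f (s *: v + x))).
by rewrite scale0r add0r.
Qed.

Lemma is_derive_coord (x v : rV) (i : 'I_n) :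
  is_derive x v (fun y : rV => y ord0 i : R) (v ord0 i).
Proof.
apply/is_derive_lineP; under eq_fun do rewrite !mxE.
rewrite (_ : (fun s => _) = (id : R -> R) * cst (v ord0 i) + cst (x ord0 i))//.
apply: is_derive_eq.
by rewrite /= scaler0 add0r addr0 [_ *: _]mulr1.
Qed.

Definition sqnorm (x : rV) : R := \sum_(i < n) x ord0 i ^+ 2.

Lemma is_derive_sqnorm (x : rV) (j : 'I_n) :
  is_derive x (delta_mx ord0 j) sqnorm (2 * x ord0 j).
Proof.
have -> : sqnorm = \sum_(i < n) (fun y : rV => y ord0 i : R) ^+ 2.
  by apply/funext => y; rewrite fct_sumE.
have D (i : 'I_n) : is_derive x (delta_mx ord0 j : rV)
   ((fun y : rV => y ord0 i : R) ^+ 2) (2 * x ord0 i * (i == j)%:R).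
  have H := is_derive_coord x (delta_mx ord0 j) i.
  by apply: is_derive_eq; rewrite /= mxE eqxx.
apply: is_derive_eq; rewrite (bigD1 j)//= eqxx mulr1 big1 ?addr0//.
by move=> i /negbTE ->; rewrite mulr0.
Qed.

Lemma continuous_sqnorm : continuous sqnorm.
Proof.
move=> x.
have sum_cvg (F : set_system rV) : Filter F ->
    (forall i, y ord0 i ^+ 2 @[y --> F] --> x ord0 i ^+ 2) ->
    sqnorm y @[y --> F] --> sqnorm x.
  by move=> FF h; apply: cvg_big => [|i _]; [exact: add_continuous|exact: h].
apply: (sum_cvg _ (nbhs_filter x)) => i.
apply: (@continuous_comp _ _ _ (fun y : rV => y ord0 i) (fun t => t ^+ 2)).
  exact: coord_continuous.
exact: exprn_continuous.
Qed.

Lemma continuous_enorm : continuous (@enorm R n).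
Proof.
move=> x; apply: (@continuous_comp _ _ _ sqnorm Num.sqrt).
  exact: continuous_sqnorm.
exact: sqrt_continuous.
Qed.

Lemma sqnorm_ge0 x : 0 <= sqnorm x.
Proof. by apply: sumr_ge0 => i _; exact: sqr_ge0. Qed.

Lemma enorm_ge0 (x : rV) : 0 <= enorm x.
Proof. exact: sqrtr_ge0. Qed.

Lemma enorm_sqr (x : rV) : enorm x ^+ 2 = sqnorm x.
Proof. by rewrite sqr_sqrtr// sqnorm_ge0. Qed.

Lemma is_derive_enorm (x : rV) (j : 'I_n) : 0 < enorm x ->
  is_derive x (delta_mx ord0 j) (@enorm R n) (x ord0 j / enorm x).
Proof.
move=> x0; have sx0 : 0 < sqnorm x by rewrite -enorm_sqr exprn_gt0.
have H := is_derive_comp_real (is_derive_sqnorm x j) (is_derive1_sqrt sx0).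
apply: is_derive_eq H _; rewrite -/(enorm x) invfM; field.
by rewrite gt_eqF.
Qed.

Lemma coord_le_enorm (x : rV) i : `|x ord0 i| <= enorm x.
Proof.
rewrite -(@ler_pXn2r _ 2)// ?nnegrE ?enorm_ge0// enorm_sqr real_normK ?num_real//.
rewrite /sqnorm (bigD1 i)//= lerDl; apply: sumr_ge0 => j _; exact: sqr_ge0.
Qed.

Lemma norm_le_enorm (x : rV) : `|x| <= enorm x.
Proof.
rewrite [X in X <= _]mx_normrE; apply: bigmax_le; first exact: enorm_ge0.
by move=> [i j] _ /=; rewrite ord1; exact: coord_le_enorm.
Qed.

End chain.

(** Continuity, outside the support of a test function, of its product with a
    function that may be irregular there. *)
Lemma locally_cst_continuous (R : realType) (T : topologicalType) (h : T -> R)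
    (x : T) (c : R) :
  (\near x, cst c x = h x) -> {for x, continuous h}.
Proof.
move=> hc; rewrite /prop_for /continuous_at -(nbhs_singleton hc).
apply: (@cvg_trans _ (cst c @ nbhs x)); last exact: cvg_cst.
exact: near_eq_cvg.
Qed.

Section ibp.
Context {R : realType} {n : nat}.
Local Notation rV := 'rV[R]_n.
Local Notation mu := (lebesgue_rV n : {measure set 'rV[R]_n -> \bar R}).

(** The function [m] need only be regular on [Omega]: the product [m * phi]
    vanishes near every point outside the support of [phi], whatever the values
    of [m] there.  This is what allows fields that are singular at the origin,
    which the annulus does not contain. *)
Lemma test_function_integration_by_parts (Omega : set rV) (phi m dm : rV -> R) (i : 'I_n) :
  test_function Omega phi ->
  (forall x, Omega x -> is_derive x (delta_mx ord0 i) m (dm x)) ->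
  (forall x, Omega x -> {for x, continuous m}) ->
  (forall x, Omega x -> {for x, continuous dm}) ->
  measurable Omega -> in_L2 Omega m ->
  mu.-integrable Omega (EFin \o (fun x => dm x * phi x)) /\
  \int[mu]_(x in Omega) (m x * partial i phi x) =
  - \int[mu]_(x in Omega) (dm x * phi x).
Proof.
move=> tphi Dm cm cdm mOmega Lm.
have [L far] := test_function_far tphi; have [sm _ supp_sub] := tphi.
have cphi : continuous phi := (sm [::]).1.
have cdphi : continuous (partial i phi) := (sm [:: i]).1.
have dphi x : is_derive x (delta_mx ord0 i) phi (partial i phi x).
  by apply: derivableP; exact: (sm [::]).2.
pose psi x := m x * phi x; pose g x := dm x * phi x + m x * partial i phi x.
have psi0 x : ~ supp phi x -> psi x = 0.
  by move=> /notin_supp_eq0 p0; rewrite /psi p0 mulr0.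
have g0 x : ~ supp phi x -> g x = 0.
  by move=> nx; rewrite /g (notin_supp_eq0 nx) (partial_notin_supp i nx) !mulr0 addr0.
have near0 x : ~ supp phi x -> \near x, ~ supp phi x.
  move=> nx; apply: open_nbhs_nbhs; split => //.
  by rewrite openC; exact: closed_closure.
have near_cst (h : rV -> R) x : (forall y, ~ supp phi y -> h y = 0) ->
    ~ supp phi x -> \near x, cst 0 x = h x.
  by move=> h0 /near0; apply: filterS => y /h0 ->.
have cont0 (h : rV -> R) x : (forall y, ~ supp phi y -> h y = 0) ->
    ~ supp phi x -> {for x, continuous h}.
  by move=> h0 nx; apply: locally_cst_continuous (near_cst h x h0 nx).
have cpsi : continuous psi.
  move=> x; have [sx|] := pselect (supp phi x); last exact: cont0.
  by apply: continuousM; [exact: (cm _ (supp_sub _ sx))|exact: cphi].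
have cg : continuous g.
  move=> x; have [sx|] := pselect (supp phi x); last exact: cont0.
  apply: (@continuousD R R _ (fun y => dm y * phi y) (fun y => m y * partial i phi y)).
    by apply: continuousM; [exact: (cdm _ (supp_sub _ sx))|exact: cphi].
  by apply: continuousM; [exact: (cm _ (supp_sub _ sx))|exact: cdphi].
have Dpsi x : is_derive x (delta_mx ord0 i) psi (g x).
  have [sx|nx] := pselect (supp phi x).
    have Dmx := Dm _ (supp_sub _ sx).
    by apply: is_derive_eq; rewrite /g [RHS]addrC; congr (_ + _); exact: mulrC.
  by rewrite g0//; apply: near_eq_is_derive (near_cst psi x psi0 nx) _.
have far0 x : L < `|x| -> psi x = 0 /\ g x = 0.
  by move=> /far nx; split; [exact: psi0|exact: g0].
have ig : mu.-integrable Omega (EFin \o g).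
  apply: (integrableS measurableT) => //.
  by apply: (integrable_continuous_vanishing cg (L := L)) => x /far0[].
have im : mu.-integrable Omega (EFin \o (fun x => m x * partial i phi x)).
  by apply: in_L2_mul_integrable => //; exact: test_function_partial_in_L2.
have idm : mu.-integrable Omega (EFin \o (fun x => dm x * phi x)).
  rewrite (_ : EFin \o _ = (EFin \o g) \- (EFin \o (fun x => (m x * partial i phi x)%R)))%E.
    exact: integrableB.
  by apply/funext => x; rewrite /= -EFinB /g addrK.
split=> //; apply/eqP; rewrite -addr_eq0 addrC -RintegralD//; apply/eqP.
rewrite /Rintegral [X in fine X](_ : _ = 0%E)//.
transitivity (\int[mu]_x (g x)%:E)%E.
  rewrite integral_mkcond; apply: eq_integral => x _ /=; rewrite patchE.
  case: ifPn => // /negP; rewrite inE => nO; rewrite g0//.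
  by move=> /supp_sub.
exact: integral_directional_derivative_eq0 cpsi cg Dpsi far0.
Qed.
End ibp.

(** * Volumes of balls and shells *)

Section annulus_geometry.
Context {R : realType} {n : nat}.
Local Notation rV := 'rV[R]_n.
Local Notation mu := (lebesgue_rV n : {measure set 'rV[R]_n -> \bar R}).

Lemma enormZ (a : R) (x : rV) : enorm (a *: x) = `|a| * enorm x.
Proof.
rewrite /enorm; under eq_bigr do rewrite mxE exprMn.
by rewrite -mulr_sumr sqrtrM ?sqr_ge0// sqrtr_sqr.
Qed.

Lemma measurable_enorm : measurable_fun setT (@enorm R n : rV -> measurableTypeR R).
Proof. by apply: continuous_measurable_rV; exact: continuous_enorm. Qed.

Lemma measurable_enorm_lt a : measurable [set x : rV | enorm x < a].
Proof.
apply: open_rV_measurable.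
by apply: (@open_comp _ _ (@enorm R n) [set t | t < a]);
  [move=> x _; exact: continuous_enorm|exact: open_lt].
Qed.

Lemma measurable_annulus (r s : R) : measurable (annulus n r s).
Proof.
apply: open_rV_measurable.
rewrite (_ : annulus n r s = @enorm R n @^-1` `]r, s[%classic).
  by apply: open_comp => [x _|]; [exact: continuous_enorm|exact: interval_open].
by apply/seteqP; split => x /=; rewrite in_itv.
Qed.

Lemma lebesgue_rV_bounded_lty (D : set rV) (s : R) : measurable D ->
  (forall x, D x -> enorm x <= s) -> (mu D < +oo)%E.
Proof.
move=> mD Ds; apply: le_lt_trans (lebesgue_cube_lty s).
apply: le_measure; rewrite ?inE//; first exact: measurable_cube.
by move=> x /Ds; exact: le_trans (norm_le_enorm x).
Qed.

Definition unit_ball_volume : R := fine (mu [set x : rV | enorm x < 1]).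

(** A ball of radius [a] is the dilate of the unit ball. *)
Lemma ball_volume a : 0 < a ->
  mu [set x : rV | enorm x < a] = (a ^+ n * unit_ball_volume)%:E.
Proof.
move=> a0; rewrite EFinM fineK; last first.
  rewrite ge0_fin_numE//; apply: (lebesgue_rV_bounded_lty (s := 1)); first exact: measurable_enorm_lt.
  by move=> x /= /ltW.
have a_neq0 : a != 0 by rewrite gt_eqF.
have := lebesgue_rV_affine (0 : rV) a_neq0 (measurable_enorm_lt a).
rewrite gtr0_norm// => H; apply: etrans (esym H) _; congr (_ * mu _)%E.
apply/seteqP; split => x /=; rewrite addr0 enormZ gtr0_norm//.
  by rewrite -{2}(mulr1 a) ltr_pM2l.
by move=> x1; rewrite -{2}(mulr1 a) ltr_pM2l.
Qed.

(** Half-open shells are differences of open balls, so that their volume is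
    exact; open annuli are squeezed between two of them. *)
Definition shell (a b : R) : set rV := [set x | a <= enorm x < b].

Lemma shellE a b : shell a b =
  [set x : rV | enorm x < b] `\` [set x | enorm x < a].
Proof.
apply/seteqP; split => x /=.
  by move=> /andP[ax xb]; split=> //; apply/negP; rewrite -leNgt.
by move=> [xb /negP]; rewrite -leNgt => ax; apply/andP.
Qed.

Lemma measurable_shell a b : measurable (shell a b).
Proof. by rewrite shellE; apply: measurableD; exact: measurable_enorm_lt. Qed.

Lemma shell_volume a b : 0 < a -> a <= b ->
  mu (shell a b) = ((b ^+ n - a ^+ n) * unit_ball_volume)%:E.
Proof.
move=> a0 ab; have b0 := lt_le_trans a0 ab.
rewrite shellE measureD; try exact: measurable_enorm_lt; last first.
  by rewrite [X in (X < _)%E](ball_volume b0) ltry.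
rewrite setIidr; last by move=> x /= /lt_le_trans; apply.
by rewrite [X in (X - _)%E](ball_volume b0) [X in (_ - X)%E](ball_volume a0) -EFinB -mulrBl.
Qed.

(** The unit ball contains the cube [0, 1/(2n)]^n. *)
Lemma unit_ball_volume_gt0 : (0 < n)%N -> 0 < unit_ball_volume.
Proof.
move=> n0; have n0' : 0 < n%:R :> R by rewrite ltr0n.
have n2 : 0 < (2 * n%:R)^-1 :> R by rewrite invr_gt0 mulr_gt0.
pose A (i : 'I_n) : set (measurableTypeR R) := `[0, (2 * n%:R)^-1]%classic.
have boxE : mu (box A) = ((2 * n%:R)^-1 ^+ n)%:E.
  transitivity (\prod_(i < n) (@lebesgue_measure R (A i)))%E.
    by apply: lebesgue_box => i; exact: measurable_itv.
  rewrite /A; under eq_bigr do rewrite lebesgue_measure_itv/= lte_fin n2 oppr0 adde0.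
  by rewrite prodEFin prodr_const card_ord.
apply: fine_gt0; apply/andP; split; last first.
  by apply: (lebesgue_rV_bounded_lty (s := 1)) => [|x /ltW//]; exact: measurable_enorm_lt.
apply: (@lt_le_trans _ _ (mu (box A))); first by rewrite boxE lte_fin exprn_gt0.
apply: le_measure; rewrite ?inE.
- by apply: measurable_box => i; exact: measurable_itv.
- exact: measurable_enorm_lt.
move=> x xA /=; rewrite -(@ltr_pXn2r _ 2)// ?nnegrE ?enorm_ge0// enorm_sqr expr1n.
apply: (@le_lt_trans _ _ (\sum_(i < n) (2 * n%:R)^-1)).
  apply: ler_sum => i _; have := xA i; rewrite /A/= in_itv/= => /andP[x0 xn].
  rewrite (le_trans _ xn)// expr2 ler_piMl// (le_trans xn)// invf_le1 ?mulr_gt0//.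
  have : 1 <= n%:R :> R by rewrite ler1n.
  lra.
rewrite sumr_const card_ord -[X in X < _]mulr_natr.
have -> : (2 * n%:R)^-1 * n%:R = 2^-1 :> R by field; rewrite gt_eqF.
lra.
Qed.

Section fixed_annulus.
Variables (r s : R).
Hypotheses (n0 : (0 < n)%N) (r0 : 0 < r) (rs : r < s).
Local Notation A := (annulus n r s).

Lemma annulus_lty : (mu A < +oo)%E.
Proof.
apply: (lebesgue_rV_bounded_lty (s := s)); first exact: measurable_annulus.
by move=> x /andP[_ /ltW].
Qed.

Definition vol (D : set rV) : R := fine (mu D).

Lemma muA_fin : mu A \is a fin_num.
Proof. by rewrite ge0_fin_numE// annulus_lty. Qed.

Lemma vol_annulus_le : vol A <= (s ^+ n - r ^+ n) * unit_ball_volume.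
Proof.
rewrite -lee_fin fineK ?muA_fin// -(shell_volume r0 (ltW rs)).
apply: le_measure; rewrite ?inE; [exact: measurable_annulus|exact: measurable_shell|].
by move=> x /andP[/ltW rx xs]; apply/andP.
Qed.

Lemma vol_shell a b : 0 < a -> a <= b ->
  vol (shell a b) = (b ^+ n - a ^+ n) * unit_ball_volume.
Proof. by move=> a0 ab; rewrite /vol shell_volume. Qed.

Lemma vol_shell_le a b : r < a -> a <= b -> b <= s -> vol (shell a b) <= vol A.
Proof.
move=> ra ab bs; rewrite -lee_fin !fineK ?muA_fin//; last first.
  by rewrite shell_volume// (lt_trans r0).
apply: le_measure; rewrite ?inE; [exact: measurable_shell|exact: measurable_annulus|].
move=> x /andP[ax xb]; apply/andP.
by rewrite (lt_le_trans ra ax) (lt_le_trans xb bs).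
Qed.

Lemma vol_annulus_gt0 : 0 < vol A.
Proof.
pose a := (r + s) / 2.
have ra : r < a by rewrite /a; move: rs; lra.
have as_ : a < s by rewrite /a; move: rs; lra.
apply: lt_le_trans (vol_shell_le ra (ltW as_) (lexx s)).
have a0 := lt_trans r0 ra; have s0 := lt_trans r0 rs.
rewrite (vol_shell a0 (ltW as_)) mulr_gt0 ?unit_ball_volume_gt0// subr_gt0.
by rewrite ltr_pXn2r// nnegrE ltW.
Qed.

(** The middle half of the annulus: its width is (s - r)/2. *)
Definition mid_shell : set rV := shell ((3 * r + s) / 4) ((r + 3 * s) / 4).

(** Factor y^n - x^n = (y - x) (y^(n-1) + ... + x^(n-1)).  The widths are in the
    ratio 2, and the second factors, with all radii in [r, s], differ at most by
    the factor (s/r)^(n-1) <= (s/r)^n. *)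
Lemma vol_mid_shell_ge : vol A <= 2 * (s / r) ^+ n * vol mid_shell.
Proof.
apply: (le_trans vol_annulus_le).
rewrite /mid_shell vol_shell; [|move: r0 rs; lra..].
rewrite mulrA ler_pM2r ?unit_ball_volume_gt0//.
set a := (3 * r + s) / 4; set b := (r + 3 * s) / 4.
have ra : r <= a by rewrite /a; move: rs; lra.
have rb : r <= b by rewrite /b; move: rs; lra.
have s0 : 0 < s by exact: lt_trans rs.
rewrite !subrXX.
have -> : b - a = (s - r) / 2 by rewrite /a /b; field.
have up : \sum_(i < n) s ^+ (n.-1 - i) * r ^+ i <= n%:R * s ^+ n.-1.
  rewrite mulr_natl -[X in _ *+ X](card_ord n) -sumr_const; apply: ler_sum => i _.
  have -> : s ^+ n.-1 = s ^+ (n.-1 - i) * s ^+ i.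
    by rewrite -exprD subnK// -ltnS prednK.
  by rewrite ler_pM2l ?exprn_gt0//; apply: lerXn2r; rewrite ?nnegrE; exact: ltW.
have low : n%:R * r ^+ n.-1 <= \sum_(i < n) b ^+ (n.-1 - i) * a ^+ i.
  rewrite mulr_natl -[X in _ *+ X](card_ord n) -sumr_const; apply: ler_sum => i _.
  have -> : r ^+ n.-1 = r ^+ (n.-1 - i) * r ^+ i.
    by rewrite -exprD subnK// -ltnS prednK.
  by apply: ler_pM; rewrite ?exprn_ge0 ?(ltW r0)//; apply: lerXn2r; rewrite // nnegrE ?(ltW r0)//; apply: le_trans (ltW r0) _.
have -> (X : R) : 2 * (s / r) ^+ n * ((s - r) / 2 * X) = (s - r) * ((s / r) ^+ n * X).
  by field.
rewrite ler_pM2l ?subr_gt0//.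
apply: (le_trans up); apply: (@le_trans _ _ ((s / r) ^+ n * (n%:R * r ^+ n.-1))); last first.
  by rewrite ler_pM2l ?exprn_gt0 ?divr_gt0.
rewrite mulrCA ler_pM2l ?ltr0n//.
have -> : (s / r) ^+ n * r ^+ n.-1 = s ^+ n.-1 * (s / r).
  by rewrite -{1}(prednK n0) exprSr mulrAC -exprMn divfK ?gt_eqF.
apply: ler_peMr; first by rewrite exprn_ge0 ?ltW.
by rewrite ler_pdivlMr// mul1r ltW.
Qed.

End fixed_annulus.
End annulus_geometry.

(** * Radial fields of divergence one *)

Section radial.
Context {R : realType} {n : nat}.
Local Notation rV := 'rV[R]_n.
Local Notation mu := (lebesgue_rV n : {measure set 'rV[R]_n -> \bar R}).

(** The field x * radial_profile c |x| has divergence 1 away from the origin: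
    x / n has divergence 1, and x |x|^-n is a multiple of the gradient of the
    fundamental solution of the Laplacian. *)
Definition radial_profile (c y : R) : R := n%:R^-1 - c * y ^- n.

(** Derivative of [radial_profile c]; the quotient is left unsimplified, which
    avoids the exponent n + 1. *)
Definition radial_profile' (c y : R) : R := c * (n%:R * y ^+ n.-1) / (y ^+ n) ^+ 2.

Lemma is_derive_radial_profile c (y : R) : 0 < y ->
  is_derive y 1 (radial_profile c) (radial_profile' c y).
Proof.
move=> y0; have yn0 : (fun t : R => t ^+ n) y != 0 by rewrite expf_neq0// gt_eqF.
have DX : is_derive y 1 (fun t : R => t ^+ n) (n%:R * y ^+ n.-1).
  have -> : (fun t : R => t ^+ n) = (id : R -> R) ^+ n by rewrite exprfctE.
  by apply: is_derive_eq; rewrite /= [_ *: _]mulr1.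
have DV := @is_deriveV R (fun t : R => t ^+ n) y _ 1 yn0 DX.
rewrite (_ : radial_profile c = cst n%:R^-1 - c *: (fun t => (t ^+ n)^-1))//.
apply: is_derive_eq; rewrite /radial_profile' /GRing.scale /=; ring.
Qed.

Lemma continuous_radial_profile c (y : R) : 0 < y ->
  {for y, continuous (radial_profile c)}.
Proof.
move=> /(is_derive_radial_profile c)[d _].
exact/differentiable_continuous/derivable1_diffP.
Qed.

Lemma continuous_radial_profile' c (y : R) : 0 < y ->
  {for y, continuous (radial_profile' c)}.
Proof.
move=> y0; have powc k : {for y, continuous (fun z : R => z ^+ k)} by exact: exprn_continuous.
have sqc : {for y, continuous (fun z : R => (z ^+ n) ^+ 2)}.
  by apply: (@continuous_comp _ _ _ (fun z : R => z ^+ n) (fun z => z ^+ 2)) => //; exact: exprn_continuous.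
have num : {for y, continuous (fun z : R => c * (n%:R * z ^+ n.-1))}.
  apply: continuousM; first exact: cst_continuous.
  by apply: continuousM; first exact: cst_continuous.
apply: (continuousM num); apply: continuousV sqc.
by rewrite !expf_neq0// gt_eqF.
Qed.

Definition radial_field c (k : 'I_n) (x : rV) : R :=
  x ord0 k * radial_profile c (enorm x).

(** Derivative of the k-th component in the k-th direction. *)
Definition radial_field' c (k : 'I_n) (x : rV) : R :=
  radial_profile c (enorm x) +
  x ord0 k * (radial_profile' c (enorm x) * (x ord0 k / enorm x)).

Lemma is_derive_radial_field c k (x : rV) : 0 < enorm x ->
  is_derive x (delta_mx ord0 k) (radial_field c k) (radial_field' c k x).
Proof.
move=> x0; have D1 := is_derive_coord x (delta_mx ord0 k) k.
have D2 := is_derive_comp_real (is_derive_enorm k x0) (is_derive_radial_profile c x0).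
rewrite (_ : radial_field c k = (fun y : rV => y ord0 k : R) * (radial_profile c \o @enorm R n))//.
by apply: is_derive_eq; rewrite /= mxE !eqxx [_ *: (1 *+ _)]mulr1 addrC.
Qed.

Lemma continuous_radial_field c k (x : rV) : 0 < enorm x ->
  {for x, continuous (radial_field c k)}.
Proof.
move=> x0; apply: (@continuousM R _ (fun y : rV => y ord0 k) (radial_profile c \o @enorm R n)).
  exact: coord_continuous.
by apply: continuous_comp; [exact: continuous_enorm|exact: continuous_radial_profile].
Qed.

Lemma continuous_radial_field' c k (x : rV) : 0 < enorm x ->
  {for x, continuous (radial_field' c k)}.
Proof.
move=> x0; apply: (@continuousD R R _ (radial_profile c \o @enorm R n)
   (fun y : rV => y ord0 k * (radial_profile' c (enorm y) * (y ord0 k / enorm y)))).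
  by apply: continuous_comp; [exact: continuous_enorm|exact: continuous_radial_profile].
apply: (@continuousM R _ (fun y : rV => y ord0 k)
   (fun y => (radial_profile' c (enorm y) * (y ord0 k / enorm y)))).
  exact: coord_continuous.
apply: (@continuousM R _ (radial_profile' c \o @enorm R n) (fun y => (y ord0 k / enorm y))).
  by apply: continuous_comp; [exact: continuous_enorm|exact: continuous_radial_profile'].
apply: (@continuousM R _ (fun y : rV => y ord0 k) (fun y => (enorm y)^-1)).
  exact: coord_continuous.
by apply: (@continuousV R _ (@enorm R n)); [rewrite gt_eqF|exact: continuous_enorm].
Qed.

Lemma radial_field_div c (x : rV) : 0 < enorm x ->
  \sum_(k < n) radial_field' c k x = 1.
Proof.
move=> x0; have [n0|n0] := posnP n.
  have : enorm x = 0.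
    rewrite /enorm big1 ?sqrtr0// => i _.
    by have := ltn_ord i; rewrite [X in (_ < X)%N]n0.
  by move=> xE; move: x0; rewrite xE ltxx.
rewrite big_split/= sumr_const card_ord.
have -> : \sum_(k < n) x ord0 k * (radial_profile' c (enorm x) * (x ord0 k / enorm x)) =
    radial_profile' c (enorm x) / enorm x * enorm x ^+ 2.
  by rewrite enorm_sqr /sqnorm mulr_sumr; apply: eq_bigr => k _; ring.
rewrite /radial_profile /radial_profile' -[_ *+ _]mulr_natl.
have nn : n%:R != 0 :> R by rewrite pnatr_eq0 -lt0n.
have ex : enorm x != 0 by rewrite gt_eqF.
have z0 : enorm x ^+ n.-1 != 0 by rewrite expf_neq0.
have : enorm x ^+ n = enorm x ^+ n.-1 * enorm x by rewrite -exprSr prednK.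
move: (enorm x ^+ n.-1) z0 => z z0 ->; field.
by rewrite nn ex z0.
Qed.
End radial.
Arguments radial_profile {R} n c y.
Arguments radial_profile' {R} n c y.

(** * The energy bound on an annulus *)

Section annulus_bound.
Context {R : realType} {n : nat}.
Local Notation rV := 'rV[R]_n.
Local Notation mu := (lebesgue_rV n : {measure set 'rV[R]_n -> \bar R}).
Variables (r s : R).
Hypotheses (n0 : (0 < n)%N) (r0 : 0 < r) (rs : r < s).
Local Notation A := (annulus n r s).

Let mA : measurable A := measurable_annulus r s.

Let A_gt0 x : A x -> 0 < enorm x.
Proof. by move=> /andP[rx _]; exact: lt_trans rx. Qed.

Lemma coord_in_L2_annulus j : in_L2 A (fun x => x ord0 j).
Proof.
apply: (in_L2_bounded mA (C := s)); first exact: annulus_lty.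
  by apply: measurable_funTS; exact: measurable_coor.
by move=> x /andP[_ /ltW]; apply: le_trans; exact: coord_le_enorm.
Qed.

Lemma measurable_radial_profile c :
  measurable_fun setT (fun x : rV => radial_profile n c (enorm x) : measurableTypeR R).
Proof.
apply: measurable_funB => //; apply: measurable_funM => //.
rewrite (_ : (fun x => _) = (fun x : rV => enorm x `^ (- n%:R))); last first.
  by apply/funext => x; rewrite powR_invn// enorm_ge0.
apply: (measurableT_comp (measurable_powR _)).
exact: measurable_enorm.
Qed.

Lemma radial_profile_bounded c x : A x ->
  `|radial_profile n c (enorm x)| <= n%:R^-1 + `|c| * r ^- n.
Proof.
move=> Ax; have x0 := A_gt0 Ax; move: Ax => /andP[rx _].
rewrite /radial_profile (le_trans (ler_normB _ _))// ger0_norm ?invr_ge0//.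
rewrite lerD2l normrM ler_wpM2l// ger0_norm ?invr_ge0 ?exprn_ge0 ?enorm_ge0//.
rewrite lef_pV2 ?posrE ?exprn_gt0//.
by apply: lerXn2r; rewrite ?nnegrE ?enorm_ge0//; exact: ltW.
Qed.

Lemma radial_field_in_L2 c k : in_L2 A (@radial_field R n c k).
Proof.
apply: (in_L2_bounded mA (C := s * (n%:R^-1 + `|c| * r ^- n))).
- exact: annulus_lty.
- apply: measurable_funTS; apply: measurable_funM; first exact: measurable_coor.
  exact: measurable_radial_profile.
- move=> x Ax; rewrite /radial_field normrM ler_pM//; last exact: radial_profile_bounded.
  by move: Ax => /andP[_ /ltW]; apply: le_trans; exact: coord_le_enorm.
Qed.

(** The matrix field dual to the coordinate function [x_j]: its row [j] is the
    radial field, its other rows are zero. *)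
Definition coord_dual_field c (j i k : 'I_n) (x : rV) : R :=
  if i == j then radial_field c k x else 0.

Lemma coord_dual_field_in_L2 c j i k : in_L2 A (coord_dual_field c j i k).
Proof.
rewrite /coord_dual_field; case: eqP => _; first exact: radial_field_in_L2.
by apply: (in_L2_bounded mA (C := 0)) => [|//|x _]; [exact: annulus_lty|rewrite normr0].
Qed.

(** For i = j, integrating by parts on both sides leaves - int phi, because the
    gradient of [x_j] is [e_j] and the radial field has divergence 1.  For i <> j
    both sides are zero. *)
Lemma coord_dual_field_weak c j i :
  weak_dual_field A (fun x => x ord0 j) i (coord_dual_field c j i).
Proof.
move=> phi tphi.
have Dcoord (x : rV) : A x ->
    is_derive x (delta_mx ord0 i) (fun y : rV => y ord0 j : R) ((i == j)%:R).
  move=> _; apply: is_derive_eq; first exact: is_derive_coord.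
  by rewrite mxE eqxx eq_sym.
have ccoord (x : rV) : A x -> {for x, continuous (fun y : rV => y ord0 j : R)}.
  by move=> _; exact: coord_continuous.
have ccst (x : rV) : A x -> {for x, continuous (fun _ : rV => (i == j)%:R : R)}.
  by move=> _; exact: cst_continuous.
have [_ ->] := test_function_integration_by_parts tphi Dcoord ccoord ccst mA
  (coord_in_L2_annulus j).
rewrite /coord_dual_field; case: eqP => _; last first.
  under eq_Rintegral do rewrite mul0r.
  rewrite big1 => [|k _]; last first.
    under eq_Rintegral do rewrite mul0r.
    by rewrite Rintegral_cst// mul0r.
  by rewrite Rintegral_cst// mul0r oppr0.
have ibp k := @test_function_integration_by_parts R n A phi
  (radial_field c k) (radial_field' c k) k tphi
  (fun x Ax => @is_derive_radial_field R n c k x (A_gt0 Ax))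
  (fun x Ax => @continuous_radial_field R n c k x (A_gt0 Ax))
  (fun x Ax => @continuous_radial_field' R n c k x (A_gt0 Ax)) mA (radial_field_in_L2 c k).
under [RHS]eq_bigr => k _ do rewrite (ibp k).2.
rewrite sumrN -Rintegral_sum//; last by move=> k; exact: (ibp k).1.
congr (- _); apply: eq_Rintegral => x; rewrite inE => Ax.
by rewrite -mulr_suml radial_field_div// A_gt0.
Qed.

Lemma coord_integrable j : mu.-integrable A (EFin \o (fun x => x ord0 j)).
Proof.
have L1 : in_L2 A (fun=> 1).
  by apply: (in_L2_bounded mA (C := 1)) => [|//|x _]; [exact: annulus_lty|rewrite normr1].
have := in_L2_mul_integrable mA (coord_in_L2_annulus j) L1.
by under eq_fun do rewrite mulr1.
Qed.

(** The annulus is invariant under x |-> - x. *)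
Lemma coord_mean_zero j : \int[mu]_(x in A) (x ord0 j) = 0.
Proof.
have AN : (fun x : rV => -1 *: x + 0) @^-1` A = A.
  by apply/seteqP; split => x; rewrite /annulus/= addr0 enormZ normrN1 mul1r.
have ix := coord_integrable j.
have fN : (fun x : rV => EFin ((-1 *: x + 0) ord0 j)) = (fun x => (-1)%:E * (x ord0 j)%:E)%E.
  by apply/funext => x; rewrite !mxE addr0 EFinM.
have := @integral_rV_affine R n (-1) 0 A (fun x => (x ord0 j)%:E).
rewrite AN fN normrN1 => /(_ erefl mA); rewrite integralZl//.
move=> H; have {}H := H _ _.
have fin : (\int[mu]_(x in A) (x ord0 j)%:E)%E \is a fin_num by exact: integrable_fin_num.
have : \int[mu]_(x in A) (x ord0 j) = - \int[mu]_(x in A) (x ord0 j).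
  apply: EFin_inj; rewrite EFinN /Rintegral !fineK// -mulN1e; apply: H.
    by apply/measurable_EFinP; exact: measurable_coor.
  exact: integrableZl.
lra.
Qed.

Lemma enorm_sqr_integrable : mu.-integrable A (EFin \o (fun x => enorm x ^+ 2)).
Proof.
have := integrable_sum mA (index_enum 'I_n) (P := predT) (h := fun i x => (x ord0 i * x ord0 i)%:E)
   (fun i _ => in_L2_mul_integrable mA (coord_in_L2_annulus i) (coord_in_L2_annulus i)).
apply: eq_integrable => // x _; rewrite /= enorm_sqr sumEFin; congr EFin.
Qed.

Definition second_moment : R := \int[mu]_(x in A) (enorm x ^+ 2).

Lemma second_momentE : second_moment = \sum_(j < n) \int[mu]_(x in A) (x ord0 j * x ord0 j).
Proof.
rewrite -Rintegral_sum//; last first.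
  by move=> i; apply: in_L2_mul_integrable => //; exact: coord_in_L2_annulus.
by apply: eq_Rintegral => x _; rewrite enorm_sqr; apply: eq_bigr => i _; rewrite expr2.
Qed.

Lemma radial_energyE c :
  \sum_(k < n) \int[mu]_(x in A) (radial_field c k x * radial_field c k x) =
  \int[mu]_(x in A) ((enorm x * radial_profile n c (enorm x)) ^+ 2).
Proof.
rewrite -Rintegral_sum//; last first.
  by move=> i; apply: in_L2_mul_integrable => //; exact: radial_field_in_L2.
apply: eq_Rintegral => x _; rewrite exprMn enorm_sqr mulr_suml.
by apply: eq_bigr => i _; rewrite /radial_field; ring.
Qed.

(** The duality bound for the coordinate [x_j] with the largest second moment,
    which is at least the average over the n coordinates. *)
Lemma bogovskii_annulus_ge c (K : R) : 0 < second_moment -> 0 < K ->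
  \int[mu]_(x in A) ((enorm x * radial_profile n c (enorm x)) ^+ 2) <= K * second_moment ->
  ((n%:R * K)^-1%:E <= bogovskii_constant A)%E.
Proof.
move=> m0 K0 energy; have nn : 0 < n%:R :> R by rewrite ltr0n.
pose F j := \int[mu]_(x in A) (x ord0 j * x ord0 j).
have [j Fj] : exists j, second_moment / n%:R <= F j.
  apply: contrapT => /forallNP h; have : second_moment < \sum_(j < n) (second_moment / n%:R).
    rewrite [X in X < _]second_momentE; apply: ltr_sum => [|j _].
      by apply/hasP; exists (Ordinal n0); rewrite ?mem_index_enum.
    by rewrite ltNge; apply/negP; exact: h.
  by rewrite sumr_const card_ord -[_ *+ _]mulr_natr divfK ?gt_eqF// ltxx.
have Fj0 : 0 < F j by apply: lt_le_trans Fj; exact: divr_gt0.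
apply: le_trans (bogovskii_constant_ge mA (coord_in_L2_annulus j)
  (coord_dual_field_in_L2 c j) (coord_dual_field_weak c j) (mulr_gt0 K0 m0) _ Fj0
  (coord_mean_zero j) (coord_integrable j)).
- rewrite lee_fin ler_pdivlMr ?mulr_gt0//; apply: le_trans Fj.
  by rewrite le_eqVlt; apply/orP; left; apply/eqP; field; rewrite !gt_eqF.
- rewrite (bigD1 j)//= [X in _ + X]big1 => [|i ij].
    apply: le_trans energy; rewrite addr0 -radial_energyE le_eqVlt; apply/orP; left.
    by apply/eqP; apply: eq_bigr => k _; rewrite /coord_dual_field eqxx.
  apply: big1 => k _; rewrite /coord_dual_field (negbTE ij).
  under eq_Rintegral do rewrite mul0r.
  by rewrite Rintegral_cst// mul0r.
Qed.

End annulus_bound.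

(** * Estimates for wide and thin annuli *)

Section estimates.
Context {R : realType} {n : nat}.
Local Notation rV := 'rV[R]_n.
Local Notation mu := (lebesgue_rV n : {measure set 'rV[R]_n -> \bar R}).
Variables (r s : R).
Hypotheses (n0 : (0 < n)%N) (r0 : 0 < r) (rs : r < s).
Local Notation A := (annulus n r s).

Let mA : measurable A := measurable_annulus r s.

Lemma integrable_cst_annulus (k : R) : mu.-integrable A (EFin \o cst k).
Proof.
apply: measurable_bounded_integrable => //; first exact: annulus_lty.
by exists `|k|; split=> [|M kM x _ /=]; [exact: num_real|exact: ltW].
Qed.

Lemma second_moment_ge : r ^+ 2 * vol A <= second_moment (n := n) r s.
Proof.
rewrite /vol -Rintegral_cst//; apply: le_Rintegral => //.
- exact: integrable_cst_annulus.
- exact: enorm_sqr_integrable.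
- by move=> x /andP[/ltW rx _]; apply: lerXn2r; rewrite ?nnegrE ?enorm_ge0 ?(ltW r0).
Qed.

Lemma second_moment_gt0 : 0 < second_moment (n := n) r s.
Proof.
by apply: lt_le_trans second_moment_ge; rewrite mulr_gt0 ?exprn_gt0 ?vol_annulus_gt0.
Qed.

Lemma energy_integrable c :
  mu.-integrable A (EFin \o (fun x => (enorm x * radial_profile n c (enorm x)) ^+ 2)).
Proof.
have := integrable_sum mA (index_enum 'I_n) (P := predT)
   (h := fun i x => (radial_field c i x * radial_field c i x)%:E)
   (fun i _ => in_L2_mul_integrable mA (radial_field_in_L2 s r0 c i) (radial_field_in_L2 s r0 c i)).
apply: eq_integrable => // x _; rewrite /= exprMn enorm_sqr sumEFin mulr_suml; congr EFin.
by apply: eq_bigr => i _; rewrite /radial_field; ring.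
Qed.

Lemma radial_profile_ratio (a y : R) : 0 < y ->
  radial_profile n (a ^+ n / n%:R) y = (1 - (a / y) ^+ n) / n%:R.
Proof.
move=> y0; rewrite /radial_profile expr_div_n.
have yn0 : y ^+ n != 0 by rewrite expf_neq0// gt_eqF.
have nn0 : n%:R != 0 :> R by rewrite pnatr_eq0 -lt0n.
by field; rewrite ?yn0 ?nn0.
Qed.

(** For c = r^n / n the radial profile is (1 - (r/|x|)^n) / n, which on the
    annulus lies between 0 and theta / n. *)
Lemma bogovskii_annulus_gt : (n%:R%:E < bogovskii_constant A)%E.
Proof.
have nn : 0 < n%:R :> R by rewrite ltr0n.
have s0 : 0 < s by exact: lt_trans rs.
pose theta : R := 1 - (r / s) ^+ n.
have rs1 : (r / s) ^+ n < 1.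
  by rewrite exprn_ilt1 ?lt0n_neq0// ?divr_ge0 ?ltW// ltr_pdivrMr// mul1r.
have rs0 : 0 < (r / s) ^+ n by rewrite exprn_gt0// divr_gt0.
have theta0 : 0 < theta by rewrite /theta; lra.
have theta1 : theta < 1 by rewrite /theta; lra.
pose K := (theta / n%:R) ^+ 2.
have K0 : 0 < K by rewrite exprn_gt0// divr_gt0.
apply: (@lt_le_trans _ _ ((n%:R * K)^-1%:E)).
  rewrite lte_fin /K.
  have -> : (n%:R * (theta / n%:R) ^+ 2)^-1 = n%:R / theta ^+ 2.
    by field; rewrite !gt_eqF.
  rewrite ltr_pdivlMr ?exprn_gt0// -[X in _ < X]mulr1 ltr_pM2l//.
  by rewrite expr_lt1// ltW.
apply: (bogovskii_annulus_ge n0 r0 (c := r ^+ n / n%:R) second_moment_gt0 K0).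
rewrite /second_moment -RintegralZl//; last exact: enorm_sqr_integrable.
apply: le_Rintegral => //; first exact: energy_integrable.
  exact: (integrableZl mA K (enorm_sqr_integrable r s)).
move=> x /andP[rx xs]; have x0 := lt_trans r0 rx.
rewrite exprMn mulrC ler_wpM2r ?sqr_ge0// radial_profile_ratio// /K.
have rx1 : (r / enorm x) ^+ n <= 1.
  by rewrite exprn_ile1 ?divr_ge0 ?ltW// ltr_pdivrMr// mul1r.
have rx2 : (r / s) ^+ n <= (r / enorm x) ^+ n.
  apply: lerXn2r; rewrite ?nnegrE ?divr_ge0 ?ltW//.
  by rewrite ltr_pM2l// ltf_pV2.
have t0 : 0 <= 1 - (r / enorm x) ^+ n by rewrite subr_ge0.
have t1 : 1 - (r / enorm x) ^+ n <= theta by rewrite lerD2l lerN2.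
apply: lerXn2r; rewrite ?nnegrE ?divr_ge0 ?(ltW theta0) ?(ltW nn)//.
by rewrite ler_pM2r ?invr_gt0.
Qed.

Local Notation p := ((s / r) ^+ n).

(** With m = (r + s)/2, p = (s/r)^n and y = m / |x|, factor 1 - y^n as
    (1 - y) (1 + y + ... + y^(n-1)); each power of y is at most p because
    y <= s / r, and |x| (1 - y) = |x| - m. *)
Lemma radial_profile_mid (x : rV) : A x ->
  (enorm x * radial_profile n (((r + s) / 2) ^+ n / n%:R) (enorm x)) ^+ 2 <=
  p ^+ 2 * (enorm x - (r + s) / 2) ^+ 2.
Proof.
move=> /andP[rx xs]; have x0 := lt_trans r0 rx.
have nn : 0 < n%:R :> R by rewrite ltr0n.
rewrite radial_profile_ratio//; set rho := enorm x in rx xs x0 *; set m := (r + s) / 2.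
have m0 : 0 < m by rewrite /m; move: r0 rs; lra.
have ms : m < s by rewrite /m; move: r0 rs; lra.
pose y := m / rho.
have y0 : 0 < y by exact: divr_gt0.
have q1 : 1 <= s / r by rewrite ler_pdivlMr// mul1r ltW.
have yq : y <= s / r.
  by rewrite ler_pM ?invr_ge0 ?ltW// ltf_pV2.
have : `|\sum_(i < n) 1 ^+ (n.-1 - i) * y ^+ i| <= n%:R * p.
  rewrite ger0_norm; last by apply: sumr_ge0 => i _; rewrite expr1n mul1r exprn_ge0 ?ltW.
  rewrite mulr_natl -[X in _ *+ X](card_ord n) -sumr_const; apply: ler_sum => i _.
  rewrite expr1n mul1r (@le_trans _ _ ((s / r) ^+ i))//.
    by apply: lerXn2r; rewrite ?nnegrE ?(ltW y0) ?(le_trans ler01 q1).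
  by apply: ler_weXn2l => //; exact: ltnW.
have -> : rho * ((1 - y ^+ n) / n%:R) = (rho - m) * ((\sum_(i < n) 1 ^+ (n.-1 - i) * y ^+ i) / n%:R).
  rewrite -{1}(expr1n _ n) subrXX /y; field.
  by rewrite !gt_eqF.
move: (\sum_(i < n) _) => S Sp.
rewrite exprMn mulrC ler_wpM2r ?sqr_ge0//.
rewrite -[leLHS]real_normK ?num_real//; apply: lerXn2r; rewrite ?nnegrE ?exprn_ge0 ?(le_trans ler01 q1)//.
by rewrite normrM normfV (gtr0_norm nn) ler_pdivrMr// mulrC.
Qed.

Local Notation mid := (@mid_shell R n r s).

(** The field of [radial_profile_mid] has square norm at most a on the annulus
    and at most a - b = p^2 ((s - r)/4)^2 on its middle half, whose volume is at
    least 1/(2p) of the total. *)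
Lemma bogovskii_annulus_thin :
  (((n%:R * ((s / r - 1) ^+ 2 * (p ^+ 2 / 4 - 3 / 32 * p)))^-1)%:E <=
   bogovskii_constant A)%E.
Proof.
have nn : 0 < n%:R :> R by rewrite ltr0n.
have s0 : 0 < s by exact: lt_trans rs.
have p1 : 1 <= p by rewrite exprn_ege1// ler_pdivlMr// mul1r ltW.
have e0 : 0 < s / r - 1 by rewrite subr_gt0 ltr_pdivlMr// mul1r.
pose m := (r + s) / 2; pose c := m ^+ n / n%:R.
have K0 : 0 < (s / r - 1) ^+ 2 * (p ^+ 2 / 4 - 3 / 32 * p).
  by rewrite mulr_gt0 ?exprn_gt0//; nra.
apply: (bogovskii_annulus_ge n0 r0 (c := c) second_moment_gt0 K0).
pose a : R := p ^+ 2 * (s - r) ^+ 2 / 4.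
pose b : R := p ^+ 2 * (s - r) ^+ 2 * (3 / 16).
have b0 : 0 <= b.
  by apply: mulr_ge0; [apply: mulr_ge0; exact: sqr_ge0|lra].
have mmid : measurable mid by exact: measurable_shell.
have midA : mid `<=` A.
  move=> x /andP[ax xb]; apply/andP; split; first by move: ax rs; lra.
  by move: xb rs; lra.
have i1 : mu.-integrable A (EFin \o (\1_mid : rV -> R)).
  apply: measurable_bounded_integrable => //; first exact: annulus_lty.
  exists 1; split; first exact: num_real.
  move=> M /ltW M1 x _ /=; rewrite indicE.
  by case: (_ \in _); rewrite ?normr1 ?normr0// (le_trans ler01).
have ib : mu.-integrable A (EFin \o (fun x => b * \1_mid x)).
  exact: (integrableZl mA b i1).
apply: (@le_trans _ _ (\int[mu]_(x in A) (cst a x - b * \1_mid x))).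
  apply: le_Rintegral => //; first exact: energy_integrable.
    exact: (integrableB mA (integrable_cst_annulus a) ib).
  move=> x Ax; apply: le_trans (radial_profile_mid Ax) _.
  rewrite indicE; move: Ax => /andP[rx xs].
  set d := s - r; have d2 : `|enorm x - m| <= d / 2.
    by rewrite ler_norml /m /d; apply/andP; split; lra.
  have sq (t : R) : `|enorm x - m| <= t -> (enorm x - m) ^+ 2 <= t ^+ 2.
    move=> xt; rewrite -[leLHS]real_normK ?num_real//; apply: lerXn2r; rewrite ?nnegrE//.
    exact: le_trans xt.
  have p20 : 0 <= p ^+ 2 by exact: sqr_ge0.
  have [xm|xm] := boolP (x \in mid).
    rewrite mulr1 [leRHS](_ : _ = p ^+ 2 * (d / 4) ^+ 2); last by rewrite /a /b -/d /=; field.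
    rewrite ler_wpM2l//; apply: sq; move: xm; rewrite inE => /andP[xl xr].
    by rewrite ler_norml /m /d; apply/andP; split; lra.
  rewrite mulr0 subr0 [leRHS](_ : _ = p ^+ 2 * (d / 2) ^+ 2); last by rewrite /a -/d /=; field.
  by rewrite ler_wpM2l//; exact: sq.
rewrite RintegralB//; last exact: (integrable_cst_annulus a).
rewrite RintegralZl// Rintegral_cst// -/(vol A).
have -> : \int[mu]_(x in A) \1_mid x = vol mid.
  rewrite /Rintegral integral_indic// /vol; congr (fine (mu _)).
  exact: setIidl.
apply: (@le_trans _ _ ((s / r - 1) ^+ 2 * (p ^+ 2 / 4 - 3 / 32 * p) * (r ^+ 2 * vol A))); last first.
  by rewrite ler_wpM2l ?second_moment_ge// ltW.
have -> : (s / r - 1) ^+ 2 * (p ^+ 2 / 4 - 3 / 32 * p) * (r ^+ 2 * vol A) =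
   a * vol A - b * (vol A / (2 * p)).
  rewrite /a /b; have : p != 0 by rewrite gt_eqF// (lt_le_trans ltr01).
  move: p => P P0; field.
  by rewrite P0 gt_eqF.
rewrite lerD2l lerN2 ler_wpM2l// ler_pdivrMr; last by rewrite mulr_gt0// (lt_le_trans ltr01).
by rewrite mulrC vol_mid_shell_ge.
Qed.

End estimates.

Theorem theorem3p6 (R : realType) (n : nat) (n_ge2 : (2 <= n)%N) :
  (forall r s : R, 0 < r -> r < s ->
     ((n%:R : R)%:E < bogovskii_constant (annulus n r s))%E) /\
  (forall r : R, 0 < r ->
     bogovskii_constant (annulus n r s) @[s --> r^'+] --> +oo%E /\
     ((3 / (n%:R - 1) : R)%:E <=
        limf_einf (fun s : R =>
          ((s / r - 1) ^+ 2)%:E * bogovskii_constant (annulus n r s))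
        r^'+)%E).
Proof.
have n0 : (0 < n)%N by exact: leq_trans n_ge2.
split=> [r s r0 rs|r r0]; first exact: bogovskii_annulus_gt.
have n2 : 2 <= n%:R :> R by rewrite (ler_nat R 2 n).
have ratio_cvg : s / r @[s --> r^'+] --> (1 : R).
  have <- : r / r = 1 by rewrite divff// gt_eqF.
  by apply: cvg_at_right_filter; apply: cvgM; [exact: cvg_id|exact: cvg_cst].
have pow_cvg k : (s / r) ^+ k @[s --> r^'+] --> (1 : R).
  have pow1 := @exprn_continuous R k 1; rewrite /continuous_at expr1n in pow1.
  exact: cvg_comp ratio_cvg pow1.
pose h (s : R) : R := n%:R * (((s / r) ^+ n) ^+ 2 / 4 - 3 / 32 * (s / r) ^+ n).
have h_cvg : h s @[s --> r^'+] --> (n%:R * (5 / 32) : R).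
  rewrite (_ : 5 / 32 = 1 / 4 - 3 / 32 * 1 :> R); last by field.
  apply: cvgM; first exact: cvg_cst.
  apply: cvgB; apply: cvgM; try exact: cvg_cst; last exact: pow_cvg.
  by under eq_fun do rewrite -exprM; exact: pow_cvg.
have h_small : \forall s \near r^'+, h s < (n%:R - 1) / 3.
  (* 5 n / 32 < (n - 1) / 3 is 17 n > 32. *)
  by apply: (cvgr_lt _ h_cvg); lra.
have bound : \forall s \near r^'+, ((3 / (n%:R - 1) : R)%:E <=
    ((s / r - 1) ^+ 2)%:E * bogovskii_constant (annulus n r s))%E.
  near=> s; have rs : r < s by near: s; exact: nbhs_right_gt.
  have q1 : 1 < s / r by rewrite ltr_pdivlMr// mul1r.
  have e0 : 0 < (s / r - 1) ^+ 2 by rewrite exprn_gt0// subr_gt0.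
  have p1 : 1 <= (s / r) ^+ n by rewrite exprn_ege1// ltW.
  have hs : h s < (n%:R - 1) / 3 by near: s.
  have h0 : 0 < h s by rewrite /h mulr_gt0 ?(lt_le_trans _ n2)//; nra.
  apply: (@le_trans _ _ (((s / r - 1) ^+ 2)%:E *
      ((n%:R * ((s / r - 1) ^+ 2 * (((s / r) ^+ n) ^+ 2 / 4 - 3 / 32 * (s / r) ^+ n)))^-1)%:E)%E).
    rewrite -EFinM lee_fin mulrCA invfM mulVKf ?gt_eqF//.
    rewrite -[leLHS]invrK lef_pV2 ?posrE ?invr_gt0 ?divr_gt0//; last by lra.
    by rewrite invf_div ltW.
  by rewrite lee_pmul2l//; exact: bogovskii_annulus_thin.
split; last first.
  rewrite limf_einfE; apply: le_trans (ereal_sup_ubound _); last first.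
    by exists [set s | ((3 / (n%:R - 1) : R)%:E <=
      ((s / r - 1) ^+ 2)%:E * bogovskii_constant (annulus n r s))%E]; first exact: bound.
  by apply: le_ereal_inf_tmp => _ [s /= bs <-].
apply/cvgeyPge => a.
have gap_cvg : (s / r - 1) ^+ 2 * a @[s --> r^'+] --> ((1 - 1) ^+ 2 * a : R).
  apply: cvgM; last exact: cvg_cst.
  have gap0 : s / r - 1 @[s --> r^'+] --> (1 - 1 : R).
    by apply: cvgB; [exact: ratio_cvg|exact: cvg_cst].
  exact: cvg_comp gap0 (@exprn_continuous R 2 (1 - 1)).
have gap_small : \forall s \near r^'+, (s / r - 1) ^+ 2 * a < 3 / (n%:R - 1).
  by apply: (cvgr_lt _ gap_cvg); rewrite subrr expr0n mul0r divr_gt0//; lra.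
near=> s; have rs : r < s by near: s; exact: nbhs_right_gt.
have e0 : 0 < (s / r - 1) ^+ 2.
  by rewrite exprn_gt0// subr_gt0 ltr_pdivlMr// mul1r.
rewrite -(@lee_pmul2l _ ((s / r - 1) ^+ 2)%:E)//.
apply: (@le_trans _ _ (3 / (n%:R - 1) : R)%:E); last by near: s.
by rewrite -EFinM lee_fin ltW//; near: s.
Unshelve. all: by end_near. Qed.
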